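(* Let $X$ be a Banach space with the Radon-Nikodým property, let $Y$ be a Banach space and let $G\in L(X,Y)$ be a norm-one operator. If $G$ has the alternative Daugavet property, then the adjoint $G^*:Y^*\to X^*$ is lush. Therefore, the following six assertions are equivalent: $G$ has the alternative Daugavet property; $G$ is a spear operator; $G$ is lush; $G^*$ has the alternative Daugavet property; $G^*$ is a spear operator; $G^*$ is lush.
   Context: Scalars are $\mathbb{K}=\mathbb{R}$ or $\mathbb{C}$; $\mathbb{T}=\{\omega\in\mathbb{K}:|\omega|=1\}$; $B_X$, $S_X$ are the closed unit ball and unit sphere; $\operatorname{aconv}(F)=\operatorname{conv}(\mathbb{T}F)$. $G\in L(X,Y)$ is a spear operator if $\sup_{\omega\in\mathbb{T}}\|G+\omega T\|=1+\|T\|$ for every $T\in L(X,Y)$; it has the alternative Daugavet property if this holds for every rank-one $T\in L(X,Y)$. A norm-one $G\in L(X,Y)$ is lush if for every $x_0\in B_X$, $\varepsilon>0$ and $y\in S_Y$ there is $F\subset B_X$ with $\operatorname{conv}(F)\subset\{x\in B_X:\|Gx+y\|>2-\varepsilon\}$ and $\operatorname{dist}(x_0,\operatorname{aconv}(F))<\varepsilon$. *)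

(* Defs.v *)
From HB Require Import structures.
From mathcomp Require Import all_boot all_order all_algebra.
From mathcomp Require Import all_classical all_reals all_analysis.
From mathcomp Require Import complex.

Set Implicit Arguments.
Unset Strict Implicit.
Unset Printing Implicit Defensive.

Import Order.TTheory GRing.Theory Num.Theory.
Import numFieldNormedType.Exports.

Local Open Scope classical_set_scope.
Local Open Scope ring_scope.

(* The scalar field is either R or R[i].  The norm of a [normedModType K] takes
   its values in K, hence in R[i] in the complex case: [re] and [of_real] pass
   between these values and the corresponding real numbers. *)
Variant scalar_kind := RealScalars | ComplexScalars.

Definition scalar_field (R : realType) (k : scalar_kind) : numFieldType :=
  match k with RealScalars => R | ComplexScalars => R[i] end.

Definition re (R : realType) (k : scalar_kind) : scalar_field R k -> R :=
  match k with RealScalars => id | ComplexScalars => @complex.Re R end.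

Definition of_real (R : realType) (k : scalar_kind) : R -> scalar_field R k :=
  match k with
  | RealScalars => id
  | ComplexScalars => fun r => real_complex R r
  end.
Arguments re {R k}.
Arguments of_real {R} k.

Section scalar_theory.
Context (R : realType) (k : scalar_kind).
Implicit Types (x y : scalar_field R k) (r s : R).

Lemma of_realK : cancel (of_real k) (@re R k).
Proof. by case: k. Qed.

Lemma re0 : re (0 : scalar_field R k) = 0.
Proof. by case: k. Qed.

Lemma re1 : re (1 : scalar_field R k) = 1.
Proof. by case: k. Qed.

Lemma of_real0 : of_real k 0 = 0 :> scalar_field R k.
Proof. by case: k. Qed.

Lemma of_realD r s : of_real k (r + s) = of_real k r + of_real k s.
Proof. by case: k => //=; rewrite rmorphD. Qed.

Lemma of_realM r s : of_real k (r * s) = of_real k r * of_real k s.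
Proof. by case: k => //=; rewrite rmorphM. Qed.

Lemma ler_of_real r s : (of_real k r <= of_real k s) = (r <= s).
Proof. by case: k => //=; rewrite lecR. Qed.

Lemma reK x : x \is Num.real -> of_real k (re x) = x.
Proof. by case: k x => //= x; exact: RRe_real. Qed.

Lemma ler_re x y :
  x \is Num.real -> y \is Num.real -> (re x <= re y) = (x <= y).
Proof. by move=> xr yr; rewrite -ler_of_real !reK. Qed.

End scalar_theory.

Section real_norm.
Context (R : realType) (k : scalar_kind) (V : normedModType (scalar_field R k)).
Implicit Types (x y : V) (A F : set V).

Definition rnorm x : R := re `|x|.

Definition unit_ball : set V := [set x | `|x| <= 1].

Definition unit_sphere : set V := [set x | `|x| = 1].

(* Extended real valued, so that the distance to the empty set is +oo. *)
Definition edistance x A : \bar R :=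
  ereal_inf [set (rnorm (x - z))%:E | z in A].

(* In [convex_set] the weights are the t : K with 0 <= t <= 1, which are real
   also when K = R[i]. *)
Definition convex_hull F : set V := smallest (@convex_set (scalar_field R k) V) F.

Definition torus : set (scalar_field R k) := [set w | `|w| = 1].

Definition aconv F : set V := convex_hull [set w *: x | w in torus & x in F].

Lemma rnormE x : of_real k (rnorm x) = `|x|.
Proof. by rewrite /rnorm reK. Qed.

Lemma rnorm_ge0 x : 0 <= rnorm x.
Proof. by rewrite -(ler_of_real k) rnormE of_real0. Qed.

Lemma rnormD x y : rnorm (x + y) <= rnorm x + rnorm y.
Proof. by rewrite -(ler_of_real k) of_realD !rnormE ler_normD. Qed.

Lemma rnormZ (c : scalar_field R k) x : rnorm (c *: x) = re `|c| * rnorm x.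
Proof.
by rewrite -[RHS](of_realK k) of_realM rnormE reK// -normrZ.
Qed.

End real_norm.

(* The Banach space L(X, Y) of bounded linear operators, as a subtype of the
   functions X -> Y. *)
Section bounded_operators.
Context (R : realType) (k : scalar_kind) (X Y : normedModType (scalar_field R k)).

Definition is_blin : pred (X -> Y) := fun f => `[< linear f /\ continuous f >].

Record blin := BLin { blin_fun :> X -> Y ; blinP : is_blin blin_fun }.

HB.instance Definition _ := [isSub for blin_fun].
HB.instance Definition _ := [Choice of blin by <:].

Lemma is_blin_submod : submod_closed is_blin.
Proof.
split.
  apply/asboolP; split; first by move=> a x y /=; rewrite scaler0 addr0.
  exact: cst_continuous.
move=> a f g /asboolP[lf cf] /asboolP[lg cg]; apply/asboolP; split.
  move=> b x y; rewrite /= !fctE lf lg !scalerDr !scalerA mulrC.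
  by rewrite addrACA.
move=> x; apply: cvgD; last exact: cg.
by apply: cvgZr; exact: cf.
Qed.

HB.instance Definition _ :=
  GRing.isSubmodClosed.Build (scalar_field R k) (X -> Y) is_blin is_blin_submod.
HB.instance Definition _ := [SubChoice_isSubLmodule of blin by <:].

Lemma blin_linear (f : blin) : linear f.
Proof. by have /asboolP[] := blinP f. Qed.

Lemma blin_continuous (f : blin) : continuous f.
Proof. by have /asboolP[] := blinP f. Qed.

HB.instance Definition _ (f : blin) :=
  GRing.isLinear.Build (scalar_field R k) X Y *:%R f (@blin_linear f).

Definition opnorm (f : blin) : R :=
  sup [set rnorm (f x) | x in @unit_ball _ _ X].

Lemma blin_bounded (f : blin) :
  has_sup [set rnorm (f x) | x in @unit_ball _ _ X].
Proof.
split; first by exists (rnorm (f 0)), 0 => //; rewrite /unit_ball /= normr0.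
have /linear_boundedP fb : bounded_near f (nbhs (0 : X)).
  exact/linear_bounded_continuous/blin_continuous.
have [M M0 Mf] := pinfty_ex_gt0 fb.
exists (re M) => _ [x x1 <-]; rewrite /rnorm ler_re ?normr_real ?gtr0_real//.
by rewrite (le_trans (Mf x))// ler_piMr// ltW.
Qed.

Lemma opnorm_ub (f : blin) x : unit_ball x -> rnorm (f x) <= opnorm f.
Proof. by move=> x1; apply: ub_le_sup; [exact: (blin_bounded f).2|exists x]. Qed.

Lemma opnorm_le (f : blin) M :
  (forall x, unit_ball x -> rnorm (f x) <= M) -> opnorm f <= M.
Proof.
move=> fM; apply: ge_sup; first exact: (blin_bounded f).1.
by move=> _ [x x1 <-]; exact: fM.
Qed.

Lemma opnorm_ge0 f : 0 <= opnorm f.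
Proof.
by rewrite (le_trans (rnorm_ge0 (f 0)))// opnorm_ub// /unit_ball/= normr0.
Qed.

Lemma ler_opnormD f g : opnorm (f + g) <= opnorm f + opnorm g.
Proof.
apply: opnorm_le => x x1.
by rewrite (le_trans (rnormD (f x) (g x)))// lerD// opnorm_ub.
Qed.

Lemma ler_opnormZ c f : opnorm (c *: f) <= re `|c| * opnorm f.
Proof.
apply: opnorm_le => x x1.
have -> : (c *: f : blin) x = c *: f x by [].
by rewrite rnormZ ler_wpM2l ?opnorm_ub// -(@re0 R k) ler_re.
Qed.

Lemma opnormZ c f : opnorm (c *: f) = re `|c| * opnorm f.
Proof.
apply/eqP; rewrite eq_le ler_opnormZ/=.
have [->|c0] := eqVneq c 0; first by rewrite normr0 re0 mul0r opnorm_ge0.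
have := ler_opnormZ c^-1 (c *: f); rewrite scalerA mulVf// scale1r.
have cgt0 : 0 < re `|c| :> R.
  rewrite lt_neqAle -(inj_eq (can_inj (of_realK k))) reK// of_real0.
  by rewrite eq_sym normr_eq0 c0/= -(@re0 R k) ler_re.
rewrite normfV => /(ler_wpM2l (ltW cgt0)) /le_trans; apply.
rewrite mulrA -[X in X * _](of_realK k) of_realM !reK ?realV//.
by rewrite divff ?normr_eq0// re1 mul1r.
Qed.

Lemma opnorm0_eq0 f : opnorm f = 0 -> f = 0.
Proof.
move=> f0; apply/val_inj/funext => x /=; apply/eqP.
have [->|x0] := eqVneq x 0; first by rewrite linear0.
have : rnorm (f (`|x|^-1 *: x)) <= 0.
  rewrite -f0 opnorm_ub// /unit_ball/= normrZ normfV normr_id.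
  by rewrite mulVf ?normr_eq0.
rewrite -(ler_of_real k) rnormE of_real0 normr_le0 linearZ/= scaler_eq0.
by rewrite invr_eq0 normr_eq0 (negbTE x0).
Qed.

Lemma rnorm_blin_le (f : blin) x : rnorm (f x) <= opnorm f * rnorm x.
Proof.
have [->|x0] := eqVneq x 0.
  by rewrite linear0 /rnorm !normr0 re0 mulr0.
have : rnorm (f (`|x|^-1 *: x)) <= opnorm f.
  by rewrite opnorm_ub// /unit_ball/= normrZ normfV normr_id mulVf ?normr_eq0.
rewrite linearZ/= -!(ler_of_real k) of_realM !rnormE normrZ normfV normr_id.
by rewrite mulrC ler_pdivrMr ?normr_gt0.
Qed.

Let norm (f : blin) : scalar_field R k := of_real k (opnorm f).

Let ler_normD f g : norm (f + g) <= norm f + norm g.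
Proof. by rewrite /norm -of_realD ler_of_real ler_opnormD. Qed.

Let normrZ c f : norm (c *: f) = `|c| * norm f.
Proof. by rewrite /norm opnormZ of_realM reK. Qed.

Let normr0_eq0 f : norm f = 0 -> f = 0.
Proof.
rewrite /norm => /(congr1 re); rewrite of_realK re0; exact: opnorm0_eq0.
Qed.

HB.instance Definition _ :=
  Lmodule_isNormed.Build (scalar_field R k) blin ler_normD normrZ normr0_eq0.

Lemma rnorm_blin (f : blin) : rnorm f = opnorm f.
Proof. exact: of_realK. Qed.

End bounded_operators.

Section adjoint.
Context (R : realType) (k : scalar_kind).
Implicit Types X Y : normedModType (scalar_field R k).

Definition dual X := blin X (scalar_field R k)^o.

Lemma is_blin_comp X Y (G : blin X Y) (f : dual Y) :
  @is_blin R k X (scalar_field R k)^o (f \o G).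
Proof.
apply/asboolP; split; first by move=> a x y; rewrite /= !linearP.
move=> x; apply: continuous_comp; exact: blin_continuous.
Qed.

Definition precomp X Y (G : blin X Y) (f : dual Y) : dual X :=
  BLin (is_blin_comp G f).

Lemma is_blin_precomp X Y (G : blin X Y) :
  @is_blin R k (dual Y) (dual X) (precomp G).
Proof.
have lG : linear (precomp G) by move=> a f g; exact/val_inj.
apply/asboolP; split=> //.
pose L : {linear dual Y -> dual X} := HB.pack (precomp G)
  (GRing.isLinear.Build (scalar_field R k) (dual Y) (dual X) *:%R (precomp G) lG).
apply: (@bounded_linear_continuous _ _ _ L).
apply/linear_boundedP; near=> r => f.
apply: (@le_trans _ _ (`|G| * `|f|)); last first.
  by rewrite ler_wpM2r//; near: r; exact: nbhs_pinfty_ge.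
rewrite -[`|L f|]rnormE -[`|G|]rnormE -[`|f|]rnormE -of_realM ler_of_real.
rewrite !rnorm_blin; apply: opnorm_le => x x1 /=.
rewrite (le_trans (rnorm_blin_le f (G x)))// mulrC.
by rewrite ler_wpM2r ?opnorm_ge0// opnorm_ub.
Unshelve. all: by end_near. Qed.

Definition adjoint X Y (G : blin X Y) : blin (dual Y) (dual X) :=
  BLin (is_blin_precomp G).

End adjoint.

Section spear_operators.
Context (R : realType) (k : scalar_kind) (X Y : normedModType (scalar_field R k)).
Implicit Types G T : blin X Y.

Definition spear_equation G T : Prop :=
  sup [set rnorm (G + w *: T) | w in @torus R k] = 1 + rnorm T.

Definition spear G : Prop := forall T, spear_equation G T.

Definition rank_one T : Prop :=
  exists2 y : Y, y != 0 & range T = [set c *: y | c in [set: scalar_field R k]].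

Definition alternative_daugavet G : Prop :=
  forall T, rank_one T -> spear_equation G T.

Definition lush G : Prop :=
  `|G| = 1 /\
  forall (x0 : X) (e : R) (y : Y),
    unit_ball x0 -> 0 < e -> unit_sphere y ->
    exists F : set X,
      [/\ F `<=` @unit_ball R k X,
          convex_hull F `<=` [set x | unit_ball x /\ 2 - e < rnorm (G x + y)]
        & (edistance x0 (aconv F) < e%:E)%E].

End spear_operators.

Section radon_nikodym_property.
Context (R : realType) (k : scalar_kind) (X : normedModType (scalar_field R k)).

Section finite_measure_space.
Context (d : measure_display) (T : measurableType d).
Variable mu : {finite_measure set T -> \bar R}.
Implicit Types (s g : T -> X) (nu : set T -> X) (E : set T).

Definition simple_function s : Prop :=
  finite_set (range s) /\ forall x, measurable (s @^-1` [set x]).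

Definition simple_integral E s : X :=
  \sum_(x \in range s) of_real k (fine (mu (E `&` s @^-1` [set x]))) *: x.

(* In the last clause, g is an almost everywhere limit of simple functions, so
   the integrand is almost everywhere equal to a measurable function. *)
Definition bochner_approximation g (s : nat -> T -> X) : Prop :=
  [/\ forall n, simple_function (s n),
      {ae mu, forall t, s n t @[n --> \oo] --> g t}
    & (\int[mu]_t (rnorm (g t - s n t))%:E)%E @[n --> \oo] --> 0%E].

Definition has_bochner_integral E g (x : X) : Prop :=
  exists2 s, bochner_approximation g s
           & simple_integral E (s n) @[n --> \oo] --> x.

Definition vector_measure nu : Prop :=
  forall E : nat -> set T, (forall n, measurable (E n)) -> trivIset setT E ->
    \sum_(i < n) nu (E i) @[n --> \oo] --> nu (\bigcup_n E n).

Definition bounded_variation nu : Prop :=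
  exists M : R, forall n (E : 'I_n -> set T),
    (forall i, measurable (E i)) -> trivIset setT E ->
    \bigcup_i E i = setT -> \sum_(i < n) rnorm (nu (E i)) <= M.

Definition abs_continuous nu : Prop :=
  forall e : R, 0 < e -> exists2 delta : R, 0 < delta &
    forall E, measurable E -> (mu E < delta%:E)%E -> rnorm (nu E) < e.

End finite_measure_space.

Definition radon_nikodym_property : Prop :=
  forall (d : measure_display) (T : measurableType d)
    (mu : {finite_measure set T -> \bar R}) (nu : set T -> X),
    vector_measure nu -> bounded_variation nu -> abs_continuous mu nu ->
    exists g : T -> X,
      forall E, measurable E -> has_bochner_integral mu E g (nu E).

End radon_nikodym_property.

(* Main.v *)
(* The Radon-Nikodym property enters only through dentability: every slice of
   B_X contains a denting point.  If not, each point x of some slice lies in the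
   closed convex hull of the points of B_X at distance at least eta from x, which
   yields a bounded X-valued martingale on [0, 1) whose increments stay bounded
   below in L^1; the vector measure it defines has a Bochner density, and
   approximating that density by simple functions contradicts this.

   If G has the alternative Daugavet property and x is a denting point, then
   z = G x is a spear vector: sup_w |y + w z| = |y| + 1 for every y.  As every
   slice contains such an x, B_X is the closed convex hull of the points mapped
   to spear vectors, and both lushness assertions follow.
   - For G: approximate x_0 by a convex combination of such points x_i and choose
     signs w_i with |y + sum_i w_i G x_i| close to n + 1; a functional norming
     this sum is almost 1 at y and at every w_i G x_i.
   - For the adjoint: choose x in the slice given by the functional of norm one;
     the unit ball of Y^* is the norm closure of aconv of the face
     {f : Re f z = 1}.
   Lush operators are spear by Hahn-Banach separation, and the alternative
   Daugavet property of G^* gives that of G by testing on adjoints of rank-one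
   operators, which closes the cycle of implications. *)
From HB Require Import structures.
Require Import Defs.
From mathcomp Require Import all_boot all_order all_algebra finmap.
From mathcomp Require Import all_classical all_reals all_analysis.
From mathcomp Require Import measurable_realfun complex ring lra.

Set Implicit Arguments.
Unset Strict Implicit.
Unset Printing Implicit Defensive.

Import Order.TTheory GRing.Theory Num.Theory.
Import numFieldNormedType.Exports.

Local Open Scope classical_set_scope.
Local Open Scope ring_scope.

(** * Scalars, real norms and sublinear functionals *)

(** A denting point x yields a spear vector because its small slices are cut by functionals H, and
    each H gives the rank-one operator T u = (H u) y with |y| = 1. Where |G u + w T u| is near 2, |H
    u| must be near 1, so a rotation of u lies in the slice, hence near x.

    The obstacle in the dentability argument is exactness: a martingale needs exact barycenters,
    whereas failure of dentability only puts points in the closure of a convex hull. Working in the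
    open ball and giving up half of the distance eta turns closure into exact combinations. The
    martingale is encoded by its vector measure, a limit of integrals over E; to make this limit
    exist for every measurable E, the sigma-algebra is the one generated by the intervals of the
    tree, so that sets adapted to finite levels are dense.

    For the adjoint, a bipolar argument would only give weak-star density of aconv of the face. Norm
    approximation is obtained by building the combination explicitly, from a functional on a finite
    power of Y with one coordinate per sign of a net of the torus. *)

Section scalars.
Context (R : realType) (k : scalar_kind).
Implicit Types (x y c w : scalar_field R k) (r s : R).

Lemma reD x y : re (x + y) = re x + re y.
Proof. by case: k x y => //= -[a b] [a' b']. Qed.

Lemma reN x : re (- x) = - re x.
Proof. by case: k x => //= -[a b]. Qed.

Lemma reB x y : re (x - y) = re x - re y.
Proof. by rewrite reD reN. Qed.

Lemma re_of_realM r x : re (of_real k r * x) = r * re x.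
Proof. by case: k x => //= -[a b] /=; rewrite mul0r subr0. Qed.

Lemma of_real1 : of_real k 1 = 1 :> scalar_field R k.
Proof. by case: k. Qed.

Lemma of_realN r : of_real k (- r) = - of_real k r :> scalar_field R k.
Proof. by case: k => //=; rewrite rmorphN. Qed.

Lemma of_realB r s : of_real k (r - s) = of_real k r - of_real k s.
Proof. by rewrite of_realD of_realN. Qed.

Lemma ltr_of_real r s : (of_real k r < of_real k s) = (r < s).
Proof. by rewrite !lt_neqAle ler_of_real (inj_eq (can_inj (@of_realK R k))). Qed.

Lemma re_norm_le x : re x <= re `|x|.
Proof.
case: k x => [x|[a b]]; first exact: ler_norm.
rewrite /re normc_def /=; rewrite (le_trans (ler_norm _))// -sqrtr_sqr.
by rewrite ler_wsqrtr// lerDl sqr_ge0.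
Qed.

Lemma norm_of_real r : `|of_real k r| = of_real k `|r|.
Proof. by case: k => //; rewrite /of_real normc_def /= expr0n addr0 sqrtr_sqr. Qed.

Lemma rotate_norm c : exists2 w, torus w & w * c = `|c|.
Proof.
have [->|c0] := eqVneq c 0.
  by exists 1; rewrite /torus/= ?normr1// normr0 mulr0.
exists (`|c| / c); last by rewrite mulfVK.
by rewrite /torus/= normrM normfV normr_id divff// normr_eq0.
Qed.

Lemma torus_neq0 w : torus w -> w != 0.
Proof. by rewrite /torus/= -normr_gt0 => ->; rewrite ltr01. Qed.

Lemma torusV w : torus w -> torus w^-1.
Proof. by rewrite /torus/= normfV => ->; rewrite invr1. Qed.

Lemma torus1 : torus (1 : scalar_field R k).
Proof. by rewrite /torus/= normr1. Qed.

End scalars.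

Section rnorm_theory.
Context (R : realType) (k : scalar_kind) (V : normedModType (scalar_field R k)).
Implicit Types (x y z : V) (w : scalar_field R k) (r : R).

Lemma rnorm0 : rnorm (0 : V) = 0.
Proof. by rewrite /rnorm normr0 re0. Qed.

Lemma rnormN x : rnorm (- x) = rnorm x.
Proof. by rewrite /rnorm normrN. Qed.

Lemma rnorm_distC x y : rnorm (x - y) = rnorm (y - x).
Proof. by rewrite -rnormN opprB. Qed.

Lemma rnormB x y : rnorm (x - y) <= rnorm x + rnorm y.
Proof. by rewrite -[rnorm y]rnormN rnormD. Qed.

Lemma rnormB_ge x y : rnorm x - rnorm y <= rnorm (x + y).
Proof.
by rewrite lerBlDr -{1}[x](addrK y) (le_trans (rnormB _ _)).
Qed.

Lemma rnorm_dist_triangle x y z : rnorm (x - z) <= rnorm (x - y) + rnorm (y - z).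
Proof. by rewrite -[x - z](subrKA y) rnormD. Qed.

Lemma rnorm_torus w x : torus w -> rnorm (w *: x) = rnorm x.
Proof. by move=> w1; rewrite rnormZ w1 re1 mul1r. Qed.

Lemma rnorm_real r x : rnorm (of_real k r *: x) = `|r| * rnorm x.
Proof. by rewrite rnormZ norm_of_real of_realK. Qed.

Lemma unit_ballE x : unit_ball x = (rnorm x <= 1) :> Prop.
Proof. by rewrite /unit_ball/= -rnormE -(of_real1 R k) ler_of_real. Qed.

Lemma unit_sphereE x : unit_sphere x <-> rnorm x = 1.
Proof.
rewrite /unit_sphere/= -rnormE -(of_real1 R k).
by split=> [/(can_inj (@of_realK R k))|->].
Qed.

Lemma rnorm_eq0 x : (rnorm x == 0) = (x == 0).
Proof.
by rewrite -(inj_eq (can_inj (@of_realK R k))) rnormE of_real0 normr_eq0.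
Qed.

Lemma rnorm_gt0 x : (0 < rnorm x) = (x != 0).
Proof. by rewrite lt_neqAle rnorm_ge0 andbT eq_sym rnorm_eq0. Qed.

Lemma rnorm_sum (I : Type) (s : seq I) (P : pred I) (f : I -> V) :
  rnorm (\sum_(i <- s | P i) f i) <= \sum_(i <- s | P i) rnorm (f i).
Proof.
elim/big_rec2: _ => [|i y1 y2 _ le12]; first by rewrite rnorm0.
by rewrite (le_trans (rnormD _ _))// lerD2l.
Qed.

Lemma re_le_rnorm (c : (scalar_field R k)^o) : re c <= rnorm c.
Proof. exact: re_norm_le. Qed.

Lemma normalize x : x != 0 ->
  exists2 u, rnorm u = 1 & x = of_real k (rnorm x) *: u.
Proof.
move=> x0; exists (of_real k (rnorm x)^-1 *: x).
  by rewrite rnorm_real ger0_norm ?invr_ge0 ?rnorm_ge0// mulVf// rnorm_eq0.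
by rewrite scalerA -of_realM divff ?rnorm_eq0// of_real1 scale1r.
Qed.

End rnorm_theory.

Section sublinear.
Context (R : realType) (k : scalar_kind) (V : lmodType (scalar_field R k)).
Implicit Types (p q f : V -> R) (x y v : V) (r s t : R).

Definition sublinear p :=
  (forall x y, p (x + y) <= p x + p y) /\
  (forall r x, 0 <= r -> p (of_real k r *: x) = r * p x).

Definition real_linear f :=
  (forall x y, f (x + y) = f x + f y) /\
  (forall r x, f (of_real k r *: x) = r * f x).

Lemma real_linear0 f : real_linear f -> f 0 = 0.
Proof. by case=> _ /(_ 0 0); rewrite scaler0 mul0r. Qed.

Lemma real_linearN f x : real_linear f -> f (- x) = - f x.
Proof. by case=> _ /(_ (-1) x); rewrite of_realN of_real1 scaleN1r mulN1r. Qed.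

Lemma real_linear_sum f (I : Type) (s : seq I) (P : pred I) (g : I -> V) :
  real_linear f ->
  f (\sum_(i <- s | P i) g i) = \sum_(i <- s | P i) f (g i).
Proof.
move=> lf; elim/big_rec2: _ => [|i y1 y2 _ <-]; first exact: real_linear0.
by rewrite lf.1.
Qed.

Lemma sublinear0 p : sublinear p -> p 0 = 0.
Proof. by case=> _ /(_ 0 0 (lexx _)); rewrite scaler0 mul0r. Qed.

Lemma sublinearN p x : sublinear p -> - p (- x) <= p x.
Proof.
by move=> sp; rewrite -subr_ge0 opprK -(sublinear0 sp) -(subrr x) sp.1.
Qed.

(** The common source of the sublinear functionals below; b keeps the infimum finite. One inequality
    for scaling is enough, since it applies to r and to its inverse; at r = 0, homogeneity for 2
    gives p 0 = 2 p 0. *)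
Lemma inf_sublinear (I : Type) (D : set I) (h : I -> V -> R) (b : V -> R) :
  D !=set0 -> (forall i x, D i -> b x <= h i x) ->
  (forall i j x y, D i -> D j ->
    exists2 l, D l & h l (x + y) <= h i x + h j y) ->
  (forall i r x, D i -> 0 < r ->
    exists2 l, D l & h l (of_real k r *: x) <= r * h i x) ->
  sublinear (fun x => inf [set h i x | i in D]).
Proof.
move=> [i0 Di0] bh hD hZ; set p := fun x => _.
have ple i x : D i -> p x <= h i x.
  by move=> Di; apply: ge_inf; [exists (b x) => _ [j Dj <-]; exact: bh|exists i].
have lep x m : (forall i, D i -> m <= h i x) -> m <= p x.
  move=> mh; apply: lb_le_inf; first by exists (h i0 x), i0.
  by move=> _ [i Di <-]; exact: mh.
have pZ r x : 0 < r -> p (of_real k r *: x) <= r * p x.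
  move=> r0; rewrite -ler_pdivrMl//; apply: lep => i Di.
  have [l Dl hl] := hZ i r x Di r0.
  by rewrite ler_pdivrMl// (le_trans _ hl)// ple.
have pZE r x : 0 < r -> p (of_real k r *: x) = r * p x.
  move=> r0; apply/eqP; rewrite eq_le pZ//= -ler_pdivlMl//.
  have := pZ r^-1 (of_real k r *: x); rewrite invr_gt0 scalerA -of_realM.
  by rewrite mulVf ?gt_eqF// of_real1 scale1r; apply.
split=> [x y|r x].
  rewrite -lerBlDr; apply: (lep) => i Di; rewrite lerBlDr -lerBlDl.
  apply: lep => j Dj; rewrite lerBlDl; have [l Dl] := hD i j x y Di Dj.
  exact/le_trans/ple.
rewrite le_eqVlt => /predU1P[<-|]; last exact: pZE.
rewrite of_real0 scale0r mul0r.
by have := pZE 2 0 (ltr0Sn _ _); rewrite scaler0; lra.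
Qed.

(* A minimal sublinear functional p is linear: comparing it with
   inf_(t >= 0) p (x + t v) - t p v gives p (x + v) >= p x + p v. *)
Theorem sublinear_minorant p :
  sublinear p -> exists2 f, real_linear f & forall x, f x <= p x.
Proof.
move=> sp; pose T := {q | sublinear q /\ forall x, q x <= p x}.
(* The order is reversed, so that a maximal element in Zorn's lemma is a minimal functional. *)
pose le (q r : T) := `[< forall x, sval r x <= sval q x >].
have [| | |A Atot|[q [sq qp]] qmin] := @Zorn T le.
- by move=> q; apply/asboolP.
- move=> q r s /asboolP qr /asboolP rs; apply/asboolP => x.
  exact: le_trans (rs x) (qr x).
- move=> [q Pq] [r Pr] /asboolP/= rq /asboolP/= qr.
  have E : q = r by apply/funext => x; apply/le_anti/andP.
  by apply: eq_exist.
- have [[q0 Aq0]|A0] := pselect (A !=set0); last first.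
    by exists (exist _ p (conj sp (fun x => lexx _))) => q Aq; case: A0; exists q.
  (* This bound, uniform in q, makes the pointwise infimum over the chain finite. *)
  have lb (q : T) x : A q -> - p (- x) <= sval q x.
    case: q => q [sq qp] /= _; rewrite (le_trans _ (sublinearN x sq))//.
    by rewrite lerN2.
  have sinf : sublinear (fun x => inf [set sval (q : T) x | q in A]).
    apply: (inf_sublinear (D := A) (h := fun q : T => sval q) (b := fun x => - p (- x))) => //.
    + by exists q0.
    + move=> q r x y Aq Ar; have [/asboolP rq|/asboolP qr] := Atot _ _ Aq Ar.
        exists r => //; case: r Ar rq => r [sr rp] /= Ar rq.
        by rewrite (le_trans (sr.1 _ _))// lerD2r.
      exists q => //; case: q Aq qr => q [sq qp] /= Aq qr.
      by rewrite (le_trans (sq.1 _ _))// lerD2l.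
    + move=> [q [sq qp]] r x Aq r0; exists (exist _ q (conj sq qp)) => //=.
      by rewrite sq.2// ltW.
  have infle (q : T) x : A q -> inf [set sval (q : T) x | q in A] <= sval q x.
    move=> Aq; apply: ge_inf; last by exists q.
    by exists (- p (- x)) => _ [r Ar <-]; exact: lb.
  have infp x : inf [set sval (q : T) x | q in A] <= p x.
    by rewrite (le_trans (infle q0 _ _))//; case: (q0) => ? [].
  pose qi : T := exist (fun q => sublinear q /\ forall x, q x <= p x)
    _ (conj sinf infp).
  exists qi => q Aq; apply/asboolP => x /=.
  exact: infle.
exists q => //.
have key v x : q x + q v <= q (x + v).
  pose h t x := q (x + of_real k t *: v) - t * q v.
  pose q' x := inf [set h t x | t in [set t | 0 <= t]].
  have lb t y : [set t | 0 <= t] t -> - q (- y) <= h t y.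
    move=> /= t0; rewrite /h lerBrDr addrC -sq.2// lerBlDr.
    by rewrite {1}(_ : of_real k t *: v = (y + of_real k t *: v) - y) ?sq.1// addrC addKr.
  have sq' : sublinear q'.
    apply: (inf_sublinear (h := h) (b := fun y => - q (- y))) => //.
    + by exists 0 => /=.
    + move=> s t y z s0 t0; exists (s + t); first by rewrite /= addr_ge0.
      rewrite /h.
      rewrite of_realD scalerDl addrACA (le_trans (lerB (sq.1 _ _) (lexx _)))//.
      by rewrite mulrDl; lra.
    + move=> t r y t0 r0; exists (r * t); first by rewrite /= mulr_ge0 // ltW.
      by rewrite /h of_realM -scalerA -scalerDr sq.2 ?(ltW r0)// mulrBr mulrA.
  have q'le t y : 0 <= t -> q' y <= h t y.
    move=> t0; apply: ge_inf; last by exists t.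
    by exists (- q (- y)) => _ [s s0 <-]; exact: lb.
  have q'q y : q' y <= q y.
    by rewrite (le_trans (q'le 0 y _))// /h of_real0 scale0r addr0 mul0r subr0.
  have q'p y : q' y <= p y by rewrite (le_trans (q'q _)).
  have /(_ (exist _ q' (conj sq' q'p)))/= := qmin.
  have le' : le (exist _ q (conj sq qp)) (exist _ q' (conj sq' q'p)).
    by apply/asboolP.
  move=> /(_ le') [qE]; have := q'le 1 x ler01.
  by rewrite qE /h of_real1 scale1r mul1r lerBrDr.
have qD x y : q (x + y) = q x + q y by apply/le_anti; rewrite sq.1 key.
have qN x : q (- x) = - q x.
  by apply/eqP; rewrite -subr_eq0 opprK -qD addNr (sublinear0 sq).
split=> // r x; have [r0|r0] := leP 0 r; first exact: sq.2.
have := sq.2 (- r) x; rewrite oppr_ge0 of_realN scaleNr qN => /(_ (ltW r0)).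
by rewrite mulNr => /oppr_inj.
Qed.

End sublinear.

(** * Hahn-Banach theorems *)

Section operators.
Context (R : realType) (k : scalar_kind).
Implicit Types X Y : normedModType (scalar_field R k).

Lemma is_blin_bounded X Y (f : X -> Y) (C : R) :
  linear f -> (forall x, rnorm (f x) <= C * rnorm x) -> is_blin f.
Proof.
move=> lf fC; apply/asboolP; split=> //.
pose L : {linear X -> Y} := HB.pack f
  (GRing.isLinear.Build (scalar_field R k) X Y *:%R f lf).
apply: (@bounded_linear_continuous _ _ _ L).
apply/linear_boundedP; near=> r => x.
apply: (@le_trans _ _ (of_real k C * `|x|)); last first.
  rewrite ler_wpM2r//; near: r; apply: nbhs_pinfty_ge.
  by rewrite realE -(of_real0 R k) !ler_of_real -realE num_real.
by rewrite -(rnormE (L x)) -(rnormE x) -of_realM ler_of_real.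
Unshelve. all: by end_near. Qed.

Lemma blin_eq X Y (f g : blin X Y) : f =1 g -> f = g.
Proof. by move=> fg; apply/val_inj/funext. Qed.

Lemma blinDE X Y (f g : blin X Y) x : (f + g) x = f x + g x.
Proof. by []. Qed.

Lemma blinZE X Y c (f : blin X Y) x : (c *: f) x = c *: f x.
Proof. by []. Qed.

Lemma blin_sumE X Y (I : Type) (s : seq I) (P : pred I) (F : I -> blin X Y) x :
  (\sum_(i <- s | P i) F i) x = \sum_(i <- s | P i) F i x.
Proof. by elim/big_rec2: _ => // i y1 y2 _ <-. Qed.

Lemma normal_blinE X Y (f : blin X Y) : `|f| = of_real k (opnorm f).
Proof. by []. Qed.

Lemma unit_normE X Y (f : blin X Y) : `|f| = 1 -> opnorm f = 1.
Proof. by rewrite normal_blinE -(of_real1 R k) => /(can_inj (@of_realK R k)). Qed.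

End operators.

Section dual.
Context (R : realType) (k : scalar_kind).
Implicit Types X : normedModType (scalar_field R k).

Lemma dual_re_le X (F : dual X) x : re (F x) <= opnorm F * rnorm x.
Proof. exact: le_trans (re_le_rnorm _) (rnorm_blin_le _ _). Qed.

Lemma dual_re_le1 X (F : dual X) x : opnorm F <= 1 -> re (F x) <= rnorm x.
Proof.
move=> F1; rewrite (le_trans (dual_re_le _ _))// ler_piMl//.
exact: rnorm_ge0.
Qed.

Lemma dual_rotate X (F : dual X) x :
  exists2 w, torus w & F (w *: x) = of_real k (rnorm (F x)).
Proof.
have [w w1 wF] := rotate_norm (F x : scalar_field R k).
by exists w => //; rewrite linearZ rnormE.
Qed.

Lemma opnorm_re_le X (F : dual X) C :
  (forall x, unit_ball x -> re (F x) <= C) -> opnorm F <= C.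
Proof.
move=> FC; apply: opnorm_le => x x1; have [w w1 wF] := dual_rotate F x.
rewrite -(of_realK k (rnorm _)) -wF FC//.
by rewrite unit_ballE rnorm_torus// -unit_ballE.
Qed.

Lemma dual_re_inj X (F H : dual X) : (forall x, re (F x) = re (H x)) -> F = H.
Proof.
move=> FH; apply/eqP; rewrite -subr_eq0; apply/eqP/opnorm0_eq0/le_anti.
rewrite opnorm_ge0 andbT; apply: opnorm_re_le => x _.
by rewrite (_ : (F - H) x = F x - H x)// reB FH subrr.
Qed.

Lemma re_real_linear X (F : dual X) : real_linear (fun x => re (F x)).
Proof.
split=> [x y|r x]; first by rewrite linearD reD.
by rewrite linearZ/= -re_of_realM.
Qed.

End dual.

Lemma real_linear_dual (R : realType) (k : scalar_kind)
    (X : normedModType (scalar_field R k)) (f : X -> R) (C : R) :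
  real_linear f -> (forall x, f x <= C * rnorm x) ->
  exists F : dual X, forall x, re (F x) = f x.
Proof.
case: k X f => X f lf fC.
  have fb x : rnorm (f x : (scalar_field R RealScalars)^o) <= C * rnorm x.
    rewrite /rnorm /re ler_norml fC andbT -lerN2 opprK -(real_linearN _ lf).
    by rewrite (le_trans (fC _))// rnormN.
  have fl : linear (f : X -> (scalar_field R RealScalars)^o).
    by move=> a x y; rewrite lf.1; congr (_ + _); exact: lf.2.
  by exists (BLin (is_blin_bounded fl fb)).
(* The only complex-linear candidate with real part f: F x = f x - i f (i x). *)
pose F x : (scalar_field R ComplexScalars)^o :=
  (f x +i* - f ('i%C *: x))%C.
have Fl : linear F.
  move=> [a b] x y; have E z : (a +i* b)%C *: z =
      of_real ComplexScalars a *: z + of_real ComplexScalars b *: ('i%C *: z).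
    rewrite scalerA -scalerDl; congr (_ *: _).
    by apply/eqP; rewrite eq_complex/=; apply/andP; split; apply/eqP; ring.
  have ii z : 'i%C *: ('i%C *: z) = - z :> X.
    rewrite scalerA (_ : _ * _ = -1) ?scaleN1r//.
    by apply/eqP; rewrite eq_complex/=; apply/andP; split; apply/eqP; ring.
  have fNi z : f ('i%C *: ((a +i* b)%C *: z)) = a * f ('i%C *: z) - b * f z.
    rewrite scalerA mulrC -scalerA E lf.1 !lf.2 ii (real_linearN _ lf).
    by rewrite mulrN.
  rewrite /F scalerDr !lf.1 fNi E lf.1 !lf.2.
  by apply/eqP; rewrite eq_complex/=; apply/andP; split; apply/eqP;
    rewrite /=; ring.
have Fb x : rnorm (F x) <= C * rnorm x.
  (* After rotating x, the value F (w x) is a nonnegative real equal to f (w x), so the bound on f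
     passes to F without loss. *)
  have [w w1 wF] := rotate_norm (F x : scalar_field R ComplexScalars).
  have : F (w *: x) = `|F x|.
    rewrite -[w *: x]addr0 Fl (_ : F 0 = 0) ?addr0//.
    by rewrite /F scaler0 (real_linear0 lf) oppr0.
  move=> /(congr1 (@re R ComplexScalars)) FE.
  by rewrite /rnorm -FE (le_trans (fC _))// rnorm_torus.
by exists (BLin (is_blin_bounded Fl Fb)).
Qed.

Section separation.
Context (R : realType) (k : scalar_kind) (X : normedModType (scalar_field R k)).
Implicit Types (x y : X) (C A : set X).

Definition real_convex A := forall (t : R) x y, 0 <= t <= 1 -> A x -> A y ->
  A (of_real k t *: x + of_real k (1 - t) *: y).

Lemma sublinear_dual (p : X -> R) (C : R) : sublinear p ->
  (forall x, p x <= C * rnorm x) ->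
  exists F : dual X, forall x, re (F x) <= p x.
Proof.
move=> sp pC; have [f lf fp] := sublinear_minorant sp.
have [x|F FE] := real_linear_dual lf (C := C).
  by rewrite (le_trans (fp _)).
by exists F => x; rewrite FE.
Qed.

(* Hahn-Banach for the sublinear functional inf_(t >= 0, c in C) |x + t c| - t r. *)
Lemma separation C (r : R) : real_convex C -> (exists c, C c) ->
  (forall c, C c -> r <= rnorm c) ->
  exists2 F : dual X, opnorm F <= 1 & forall c, C c -> r <= re (F c).
Proof.
move=> cC [c0 Cc0] Cr.
pose D := [set tc : R * X | 0 <= tc.1 /\ C tc.2].
pose h (tc : R * X) x := rnorm (x + of_real k tc.1 *: tc.2) - tc.1 * r.
pose p x := inf [set h i x | i in D].
have lb i x : D i -> - rnorm x <= h i x.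
  case: i => t c [/= t0 Cc]; rewrite /h /=.
  have := rnormB_ge (of_real k t *: c) x; rewrite rnorm_real ger0_norm//.
  rewrite [of_real _ _ *: _ + _]addrC.
  by have := ler_wpM2l t0 (Cr _ Cc); lra.
have sp : sublinear p.
  apply: (inf_sublinear (h := h) (b := fun x => - rnorm x)) => //.
  - by exists (0, c0); split=> /=.
  - move=> [s c] [t d] x y [/= s0 Cc] [/= t0 Cd].
    (* The weighted mean of c and d makes no sense for s = t = 0, where any point of C serves. *)
    have [st0|st0] := eqVneq (s + t) 0.
      have [-> ->] : s = 0 /\ t = 0 by split; lra.
      exists (0, c0); first by split=> /=.
      rewrite /h/= !of_real0 !scale0r !addr0 !mul0r !subr0; exact: rnormD.
    have st : 0 < s + t by rewrite lt_neqAle eq_sym st0 addr_ge0.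
    exists (s + t, of_real k (s / (s + t)) *: c + of_real k (1 - s / (s + t)) *: d).
      split; first exact: ltW.
      apply: cC => //; rewrite divr_ge0 ?(ltW st)//= ler_pdivrMr// mul1r.
      by rewrite lerDl.
    rewrite /h /= scalerDr !scalerA -!of_realM.
    have -> : (s + t) * (s / (s + t)) = s by rewrite mulrC divfK.
    have -> : (s + t) * (1 - s / (s + t)) = t by field.
    rewrite addrACA.
    have := rnormD (x + of_real k s *: c) (y + of_real k t *: d).
    by rewrite mulrDl; lra.
  - move=> [t c] s x [/= t0 Cc] s0; exists (s * t, c).
      by split; rewrite //= mulr_ge0// ltW.
    rewrite /h/= of_realM -scalerA -scalerDr rnorm_real gtr0_norm//.
    by rewrite mulrBr mulrA.
have ple i x : D i -> p x <= h i x.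
  move=> Di; apply: ge_inf; last by exists i.
  by exists (- rnorm x) => _ [j Dj <-]; exact: lb.
have pn x : p x <= 1 * rnorm x.
  have /(le_trans (ple (0, c0) x _)) : h (0, c0) x <= 1 * rnorm x.
    by rewrite /h/= of_real0 scale0r addr0 mul0r subr0 mul1r.
  by apply; split=> /=.
have [F Fp] := sublinear_dual sp pn; exists F.
  apply: opnorm_re_le => x x1; rewrite (le_trans (Fp _))//.
  by rewrite (le_trans (pn _))// mul1r -unit_ballE.
(* At - c, the choice t = 1 gives p (- c) <= |0| - r. *)
move=> c Cc; have := le_trans (Fp (- c)) (ple (1, c) _ _).
rewrite linearN reN /h/= of_real1 scale1r mul1r addNr rnorm0 sub0r lerN2.
by apply; split=> /=.
Qed.

Lemma norming y : exists2 F : dual X, opnorm F <= 1 & re (F y) = rnorm y.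
Proof.
have [| |c ->|F F1 Fy] := @separation [set y] (rnorm y) => //.
- by move=> t x z _ -> ->; rewrite -scalerDl -of_realD addrC subrK of_real1 scale1r.
- by exists y.
exists F => //; apply/le_anti; rewrite Fy// andbT.
exact: dual_re_le1.
Qed.

End separation.

Section adjoint_norm.
Context (R : realType) (k : scalar_kind).
Implicit Types X Y : normedModType (scalar_field R k).

Lemma adjointE X Y (G : blin X Y) (f : dual Y) x : adjoint G f x = f (G x).
Proof. by []. Qed.

Lemma opnorm_adjoint X Y (G : blin X Y) : opnorm (adjoint G) = opnorm G.
Proof.
apply/le_anti/andP; split.
  apply: opnorm_le => f; rewrite unit_ballE rnorm_blin => f1.
  rewrite rnorm_blin; apply: opnorm_le => x x1.
  rewrite adjointE (le_trans (rnorm_blin_le _ _))//.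
  rewrite -[leRHS]mul1r ler_pM ?opnorm_ge0 ?rnorm_ge0//; exact: opnorm_ub.
apply: opnorm_le => x x1; have [f f1 <-] := norming (G x).
rewrite -adjointE (le_trans (dual_re_le _ _))// -[leRHS]mulr1.
rewrite ler_pM ?opnorm_ge0 ?rnorm_ge0 -?unit_ballE// -rnorm_blin.
by apply: opnorm_ub; rewrite unit_ballE rnorm_blin.
Qed.

Lemma adjointD X Y (G T : blin X Y) : adjoint (G + T) = adjoint G + adjoint T.
Proof. by apply: blin_eq => f; apply: blin_eq => x; rewrite adjointE linearD. Qed.

Lemma adjointZ X Y c (G : blin X Y) : adjoint (c *: G) = c *: adjoint G.
Proof. by apply: blin_eq => f; apply: blin_eq => x; rewrite adjointE linearZ. Qed.

End adjoint_norm.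

(** * Real-valued finite measures and Bochner integrals *)

Section finite_measure_real.
Context (R : realType) (d : measure_display) (T : measurableType d).
Context (mu : {finite_measure set T -> \bar R}).
Implicit Types A B E : set T.

Definition rmeasure E : R := fine (mu E).
Local Notation m := rmeasure.

Lemma rmeasureE E : measurable E -> (m E)%:E = mu E.
Proof. by move=> mE; rewrite fineK// fin_num_measure. Qed.

Lemma rmeasure_ge0 E : 0 <= m E.
Proof. by rewrite fine_ge0. Qed.

Lemma rmeasure0 : m set0 = 0.
Proof. by rewrite /m measure0. Qed.

Lemma rmeasureU A B : measurable A -> measurable B -> A `&` B = set0 ->
  m (A `|` B) = m A + m B.
Proof.
move=> mA mB AB; apply: EFin_inj; rewrite EFinD !rmeasureE//.
  by rewrite measureU.
exact: measurableU.
Qed.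

Lemma rmeasureDI A B : measurable A -> measurable B ->
  m A = m (A `&` B) + m (A `\` B).
Proof.
move=> mA mB; rewrite -rmeasureU.
- congr m; apply/seteqP; split=> [t At|t [[]|[]]//].
  by have [Bt|nBt] := pselect (B t); [left|right].
- exact: measurableI.
- exact: measurableD.
- by apply/seteqP; split=> // t [[_ Bt] [_]].
Qed.

Lemma le_rmeasure A B : measurable A -> measurable B -> A `<=` B -> m A <= m B.
Proof.
move=> mA mB AB; rewrite (rmeasureDI mB mA) (setIidr AB).
by rewrite lerDl rmeasure_ge0.
Qed.

Lemma rmeasureU_le A B : measurable A -> measurable B -> m (A `|` B) <= m A + m B.
Proof.
move=> mA mB; rewrite (rmeasureDI (measurableU _ _ mA mB) mA).
have mAB : measurable (A `|` B) by exact: measurableU.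
rewrite lerD//; apply: le_rmeasure => //.
- exact: measurableI.
- exact: measurableD.
- by move=> t [[]].
Qed.

Lemma rmeasure_sum_fibers (W : eqType) (u : T -> W) E (s : seq W) :
  uniq s -> measurable E -> (forall w, measurable (u @^-1` [set w])) ->
  m (E `&` [set t | u t \in s]) = \sum_(w <- s) m (E `&` u @^-1` [set w]).
Proof.
move=> us mE mu_; elim: s us => [_|w s IH /= /andP[ws us]].
  rewrite big_nil (_ : [set t | _] = set0) ?setI0 ?rmeasure0//.
  by apply/seteqP; split.
have consE w' (r : seq W) : [set t | u t \in w' :: r] =
    u @^-1` [set w'] `|` [set t | u t \in r].
  apply/seteqP; split=> t /=; first by rewrite inE => /predU1P.
  by rewrite inE => -[->|->]; rewrite ?eqxx ?orbT.
have ms (r : seq W) : measurable (E `&` [set t | u t \in r]).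
  elim: r => [|w' r IHr].
    by rewrite (_ : [set t | _] = set0) ?setI0//; apply/seteqP; split.
  by rewrite consE setIUr; apply: measurableU => //; exact: measurableI.
rewrite big_cons -IH// -rmeasureU//; last 2 first.
- exact: measurableI.
- apply/seteqP; split=> // t [[_ /= tw] [_ /=]]; rewrite tw.
  by move: ws => /[swap] ->.
by rewrite -setIUr consE.
Qed.

Lemma rmeasure_tail (E : (set T)^nat) (e : R) : (forall i, measurable (E i)) ->
  0 < e -> \forall n \near \oo,
    m ((\bigcup_i E i) `\` \big[setU/set0]_(i < n) E i) < e.
Proof.
move=> mE e0; pose F n := (\bigcup_i E i) `\` \big[setU/set0]_(i < n) E i.
have mU : measurable (\bigcup_i E i) by exact: bigcup_measurable.
have mF n : measurable (F n).
  by apply: measurableD => //; exact: bigsetU_measurable.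
have F0 : \bigcap_n F n = set0.
  apply/seteqP; split=> // t Ft; have [[i _ Eit] _] := Ft 0%N I.
  have [_ /=] := Ft i.+1 I; apply.
  by rewrite big_ord_recr/=; right.
have : mu \o F @ \oo --> mu (\bigcap_n F n).
  apply: nonincreasing_cvg_mu => //.
  - by rewrite ltey_eq fin_num_measure.
  - by rewrite F0.
  - move=> i j ij; apply/subsetPset => t [Ut nt]; split=> //; apply: contra_not nt.
    by rewrite -!bigcup_mkord => -[l /= li El]; exists l => //=; exact: leq_trans ij.
rewrite F0 measure0 => /fine_cvgP[_ /cvgrPdist_lt/(_ _ e0)].
apply: filterS => n /=; rewrite sub0r normrN ger0_norm//.
exact: rmeasure_ge0.
Qed.

End finite_measure_real.

Section rnorm_limits.
Context (R : realType) (k : scalar_kind) (V : normedModType (scalar_field R k)).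

Lemma cvg_rnormP (T : Type) (F : set_system T) (FF : Filter F) (f : T -> V) (l : V) :
  f @ F --> l <-> forall e : R, 0 < e -> \forall x \near F, rnorm (l - f x) < e.
Proof.
split=> [fl e e0|fl].
  have ek0 : 0 < of_real k e by rewrite -(of_real0 R k) ltr_of_real.
  have /cvgrPdist_lt/(_ _ ek0) := fl.
  by apply: filterS => x; rewrite -rnormE ltr_of_real.
apply/cvgrPdist_lt => e e0.
have eE : of_real k (re e) = e by rewrite reK// gtr0_real.
have /fl : 0 < re e by rewrite -(ltr_of_real k) of_real0 eE.
by apply: filterS => x; rewrite -{2}eE -rnormE ltr_of_real.
Qed.

Lemma rnorm_dist_dist (a b : V) : `|rnorm a - rnorm b| <= rnorm (a - b).
Proof.
rewrite ler_norml; apply/andP; split.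
  by rewrite lerNl opprB lerBlDr rnorm_distC -{1}[b](subrK a) rnormD.
by rewrite lerBlDr -{1}[a](subrK b) rnormD.
Qed.

Lemma cvg_rnorm (T : Type) (F : set_system T) (FF : Filter F) (f : T -> V) (l : V) :
  f @ F --> l -> (fun x => rnorm (f x)) @ F --> rnorm l.
Proof.
move=> /cvg_rnormP fl; apply/cvgrPdist_lt => e /fl; apply: filterS => x.
exact/le_lt_trans/rnorm_dist_dist.
Qed.

End rnorm_limits.

Section finite_range.
Context (R : realType) (d : measure_display) (T : measurableType d).
Context (mu : {finite_measure set T -> \bar R}).
Local Notation m := (rmeasure mu).

(** The condition of [simple_function] for values in any type, so that several simple functions can
    be paired and treated on one common partition. *)
Definition finite_range (W : Type) (u : T -> W) : Prop :=
  finite_set (range u) /\ forall w, measurable (u @^-1` [set w]).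

Lemma finite_range_pair (W W' : choiceType) (u : T -> W) (v : T -> W') :
  finite_range u -> finite_range v -> finite_range (fun t => (u t, v t)).
Proof.
move=> [fu mu_] [fv mv]; split.
  apply: (sub_finite_set _ (finite_setX fu fv)) => _ [t _ <-] /=.
  by split; exists t.
move=> [w w']; rewrite (_ : _ @^-1` _ = (u @^-1` [set w]) `&` (v @^-1` [set w'])).
  exact: measurableI.
by apply/seteqP; split=> t /= [-> ->].
Qed.

Lemma finite_range_seq (W : choiceType) (u : T -> W) : finite_range u ->
  exists2 s : seq W, uniq s & forall t, u t \in s.
Proof.
move=> [fu _]; exists (fset_set (range u)).
  exact: fset_uniq.
by move=> t; rewrite in_fset_set// inE; exists t.
Qed.

Lemma finite_range_comp (W W' : choiceType) (u : T -> W) (phi : W -> W') :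
  finite_range u -> finite_range (phi \o u).
Proof.
move=> [fu mu_]; split; first by have := finite_image phi fu; rewrite image_comp.
move=> w; rewrite (_ : _ @^-1` _ =
    \bigcup_(x in range u `&` [set x | phi x = w]) u @^-1` [set x]).
  apply: fin_bigcup_measurable => [|x _]; last exact: mu_.
  by apply: (sub_finite_set _ fu) => x [].
apply/seteqP; split=> [t /= <-|t [x [_ /= <-] /= ->]]//.
by exists (u t) => //; split=> //; exists t.
Qed.

Lemma finite_range_measurable (u : T -> R) : finite_range u ->
  measurable_fun setT u.
Proof.
move=> [fu mu_] _ B mB; rewrite setTI (_ : _ @^-1` _ =
    \bigcup_(x in range u `&` B) u @^-1` [set x]).
  apply: fin_bigcup_measurable => [|x _]; last exact: mu_.
  by apply: (sub_finite_set _ fu) => x [].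
apply/seteqP; split=> [t /= Bt|t [x [_ Bx] /= ->]]//.
by exists (u t) => //; split=> //; exists t.
Qed.

Lemma finite_range_integral (W : choiceType) (u : T -> W) (phi : W -> R)
    (s : seq W) (E : set T) :
  finite_range u -> uniq s -> (forall t, u t \in s) -> measurable E ->
  (forall w, 0 <= phi w) ->
  (\int[mu]_(t in E) (phi (u t))%:E =
   (\sum_(w <- s) m (E `&` u @^-1` [set w]) * phi w)%:E)%E.
Proof.
move=> [fu mu_] us su mE phi0.
have E1 t : (phi (u t))%:E =
    (\sum_(w <- s) (phi w)%:E * (\1_(u @^-1` [set w]) t)%:E)%E.
  rewrite (bigD1_seq (u t))//= big1 ?adde0 => [|w wu].
    by rewrite indicE mem_set ?mule1.
  rewrite indicE memNset ?mule0// => /= uw.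
  by move: wu; rewrite uw eqxx.
have mi w : measurable_fun E (EFin \o (\1_(u @^-1` [set w]) : T -> R)).
  apply/measurable_EFinP; exact: measurable_indic.
under eq_integral do rewrite E1.
rewrite ge0_integral_sum//; last 2 first.
- by move=> w; exact: (measurable_funeM _ (mi w)).
- by move=> w t _; rewrite mule_ge0 ?lee_fin ?phi0.
rewrite -sumEFin; apply: eq_bigr => w _.
rewrite ge0_integralZl_EFin//; last exact: mi.
rewrite integral_indic// setIC EFinM rmeasureE; last exact: measurableI.
by rewrite muleC.
Qed.

End finite_range.

Section simple_integral.
Context (R : realType) (k : scalar_kind) (X : normedModType (scalar_field R k)).
Context (d : measure_display) (T : measurableType d).
Context (mu : {finite_measure set T -> \bar R}).
Local Notation m := (rmeasure mu).

(** Computes the integral on a partition finer than the fibers of the integrand, since [phi] may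
    identify values of [u]. Two simple functions are compared by taking for [u] their pair. *)
Lemma simple_integralE (W : choiceType) (u : T -> W) (phi : W -> X) (s : seq W)
    (E : set T) :
  finite_range u -> uniq s -> (forall t, u t \in s) -> measurable E ->
  simple_integral mu E (phi \o u) =
  \sum_(w <- s) of_real k (m (E `&` u @^-1` [set w])) *: phi w.
Proof.
move=> fu us su mE; have [fp mp] := finite_range_comp phi fu.
rewrite /simple_integral fsbig_finite//=.
set r := fset_set _.
have rP t : phi (u t) \in r by rewrite in_fset_set// inE; exists t.
have step x : of_real k (fine (mu (E `&` (phi \o u) @^-1` [set x]))) *: x =
    \sum_(w <- s | phi w == x) of_real k (m (E `&` u @^-1` [set w])) *: phi w.
  transitivity (\sum_(w <- s | phi w == x) of_real k (m (E `&` u @^-1` [set w])) *: x).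
    rewrite -scaler_suml; congr (_ *: _).
    have := rmeasure_sum_fibers mu (filter_uniq (fun w => phi w == x) us) mE fu.2.
    rewrite big_filter => E1.
    rewrite -(big_morph (of_real k) (@of_realD R k) (of_real0 R k)) -E1.
    congr (of_real k (fine (mu (_ `&` _)))); apply/seteqP; split=> t /=.
      by move=> ux; rewrite mem_filter su ux eqxx.
    by rewrite mem_filter => /andP[/eqP].
  by apply: eq_bigr => w /eqP ->.
under eq_bigr do rewrite step.
rewrite (exchange_big_dep xpredT)//= big_seq [in RHS]big_seq.
apply: eq_bigr => w ws; have [[t uw]|nt] := pselect (exists t, u t = w).
  rewrite big_mkcond (bigD1_seq (phi w)) ?fset_uniq//= -?uw ?rP//.
  by rewrite eqxx big1 ?addr0// => x /negbTE; rewrite eq_sym => ->.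
have -> : E `&` u @^-1` [set w] = set0.
  by apply/seteqP; split=> // t [_ /= uw]; apply: nt; exists t.
by rewrite rmeasure0 of_real0 scale0r big1// => *; rewrite scale0r.
Qed.

Lemma simple_integral_dist (s1 s2 : T -> X) (E : set T) :
  finite_range s1 -> finite_range s2 -> measurable E ->
  ((rnorm (simple_integral mu E s1 - simple_integral mu E s2))%:E <=
   \int[mu]_(t in E) (rnorm (s1 t - s2 t))%:E)%E.
Proof.
move=> f1 f2 mE; have fu := finite_range_pair f1 f2.
have [r ur sr] := finite_range_seq fu.
rewrite (finite_range_integral mu (phi := fun w : X * X => rnorm (w.1 - w.2)) fu ur)//;
  last by move=> w; exact: rnorm_ge0.
rewrite lee_fin.
have -> : simple_integral mu E s1 = _ := simple_integralE fst fu ur sr mE.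
have -> : simple_integral mu E s2 = _ := simple_integralE snd fu ur sr mE.
rewrite -sumrB (le_trans (rnorm_sum _ _ _))//.
apply: ler_sum => w _; rewrite -scalerBr rnorm_real ger0_norm//.
exact: rmeasure_ge0.
Qed.

(* The integrand in [bochner_approximation] need not be measurable, so it is
   replaced by a measurable function which vanishes on a null set. *)
Lemma bochner_control (g : T -> X) (nu : set T -> X) (e : R) : 0 < e ->
  (forall E, measurable E -> has_bochner_integral mu E g (nu E)) ->
  exists (s : T -> X) (h : T -> R),
    [/\ finite_range s, measurable_fun setT h, forall t, 0 <= h t,
        (\int[mu]_t (h t)%:E <= e%:E)%E &
        forall E, measurable E ->
          ((rnorm (nu E - simple_integral mu E s))%:E <=
           \int[mu]_(t in E) (h t)%:E)%E].
Proof.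
move=> e0 gnu.
pose trunc (N : set T) (s : T -> X) t : R :=
  if `[< N t >] then 0 else rnorm (g t - s t).
have trunc_ge0 N s t : 0 <= trunc N s t.
  by rewrite /trunc; case: ifP => // _; exact: rnorm_ge0.
have control E : measurable E -> exists (s : nat -> T -> X) (N : set T),
    [/\ measurable N, mu N = 0%E, (forall n, finite_range (s n)),
      (forall s', finite_range s' -> measurable_fun setT (trunc N s')) &
      (\int[mu]_t (trunc N (s n) t)%:E @[n --> \oo] --> 0)%E /\
      simple_integral mu E (s n) @[n --> \oo] --> nu E].
  move=> /gnu[s [fs [N [mN N0 sN]] sg] sE]; exists s, N.
  have cv t : ~ N t -> s n t @[n --> \oo] --> g t.
    by move=> Nt; apply: contrapT => /(sN t).
  (* Off N, |g - s'| is the pointwise limit of the measurable functions |s n - s'|. *)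
  have mtr s' : finite_range s' -> measurable_fun setT (trunc N s').
    move=> fs'; pose h n t := if `[< N t >] then 0 else rnorm (s n t - s' t).
    apply: (@measurable_fun_cvg _ _ _ _ h) => [n|t _].
      apply: finite_range_measurable.
      have fN : finite_range (fun t => `[< N t >]).
        split.
          apply: (@sub_finite_set _ _ [set true; false]) => [[]|]; by [left|right|].
        move=> [|].
          rewrite (_ : _ @^-1` _ = N)//; apply/seteqP; split=> t /=.
            by move=> /asboolP.
          by move=> Nt; exact/asboolP.
        rewrite (_ : _ @^-1` _ = ~` N); first exact: measurableC.
        apply/seteqP; split=> t /=; first by move=> /negbT/asboolPn.
        by move=> Nt; apply/negbTE/asboolPn.
      exact: (finite_range_comp (fun w : bool * (X * X) => if w.1 then 0 else
        rnorm (w.2.1 - w.2.2)) (finite_range_pair fN (finite_range_pair (fs n) fs'))).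
    rewrite /h /trunc; case: asboolP => [_|Nt]; first exact: cvg_cst.
    apply: cvg_rnorm; apply: cvgB; [exact: cv|exact: cvg_cst].
  split=> //; split=> //.
  apply: (squeeze_cvge _ (cvg_cst _) sg).
  apply: nearW => n; rewrite integral_ge0/=; last by move=> t Tt; rewrite lee_fin.
  (* Both integrals are suprema over the simple functions below the integrand, a form in which
     monotonicity asks for no measurability. *)
  rewrite !ge0_integralTE; last 2 first.
  - by move=> t; rewrite lee_fin rnorm_ge0.
  - by move=> t; rewrite lee_fin.
  apply: le_ereal_sup => _ [h hle <-]; exists h => // t.
  rewrite (le_trans (hle t))// lee_fin /trunc; case: ifP => // _.
  exact: rnorm_ge0.
have [s [N [mN N0 fs mtr [s0 _]]]] := control _ measurableT.
have /fine_cvgP[sfin /cvgrPdist_lt/(_ _ e0) sfine] := s0.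
have [n [nfin nlt]] : exists n, (\int[mu]_t (trunc N (s n) t)%:E)%E \is a fin_num /\
    `|0 - fine (\int[mu]_t (trunc N (s n) t)%:E)%E| < e.
  near \oo => n; exists n; split; near: n; [exact: sfin|exact: sfine].
exists (s n), (trunc N (s n)); split=> //; first exact: mtr.
  rewrite -(fineK nfin) lee_fin ltW// (le_lt_trans _ nlt)// sub0r normrN.
  exact: ler_norm.
(* The sequence given for E need not be the one given for the whole space. Both approximate g, so
   off N and N' they are compared by the triangle inequality through g; then j tends to infinity. *)
move=> E mE; have [s' [N' [mN' N'0 fs' mtr' [s'0 s'E]]]] := control _ mE.
set I := (\int[mu]_(t in E) _)%E.
have mEf (f : T -> R) : measurable_fun setT f -> measurable_fun E (EFin \o f).
  by move=> mf; apply/measurable_EFinP; exact: measurable_funTS.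
have bnd j : ((rnorm (simple_integral mu E (s' j) - simple_integral mu E (s n)))%:E
    <= \int[mu]_t (trunc N' (s' j) t)%:E + I)%E.
  apply: (le_trans (simple_integral_dist _ _ mE)) => //.
  have mdist : measurable_fun setT (fun t => rnorm (s' j t - s n t)).
    apply: finite_range_measurable.
    exact: (finite_range_comp (fun w : X * X => rnorm (w.1 - w.2))
      (finite_range_pair (fs' j) (fs n))).
  apply: (@le_trans _ _ (\int[mu]_(t in E) (trunc N' (s' j) t)%:E + I)%E); last first.
    rewrite leeD2r// ge0_subset_integral//.
      by apply/measurable_EFinP; exact: mtr'.
    by move=> t Tt; rewrite lee_fin.
  rewrite /I -ge0_integralD//; last 4 first.
  - by move=> t Et; rewrite lee_fin.
  - by apply: mEf; exact: mtr'.
  - by move=> t Et; rewrite lee_fin.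
  - by apply: mEf; exact: mtr.
  apply: ae_ge0_le_integral => //.
  - by move=> t _; rewrite lee_fin rnorm_ge0.
  - exact: mEf.
  - by move=> t _; rewrite adde_ge0// lee_fin.
  - apply: emeasurable_funD; apply: mEf; [exact: mtr'|exact: mtr].
  exists (N `|` N'); split; first exact: measurableU.
    by rewrite measureU0.
  move=> t /= /not_implyP[_]; apply: contra_notP => /not_orP[nN nN'].
  rewrite -EFinD lee_fin /trunc !asboolF// [rnorm (g t - s' j t)]rnorm_distC.
  exact: rnorm_dist_triangle.
have : (fun j => (rnorm (simple_integral mu E (s' j) - simple_integral mu E (s n)))%:E)
    @ \oo --> (rnorm (nu E - simple_integral mu E (s n)))%:E.
  apply: cvg_EFin; first exact: nearW.
  by apply: cvg_rnorm; apply: cvgB => //; exact: cvg_cst.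
move=> lim1; have lim2 : ((\int[mu]_t (trunc N' (s' j) t)%:E + I)%E @[j --> \oo] --> I)%E.
  have I0 : (0 <= I)%E by apply: integral_ge0 => t _; rewrite lee_fin.
  have {2}<- : (0 + I)%E = I by rewrite add0e.
  by apply: cvgeD => //; exact: cvg_cst.
rewrite -(cvg_lim _ lim1)// -(cvg_lim _ lim2)//; apply: lee_lim.
- by apply/cvg_ex; eexists; exact: lim1.
- by apply/cvg_ex; eexists; exact: lim2.
- exact: nearW.
Unshelve. all: by end_near. Qed.

End simple_integral.

(** * Martingales in spaces with the Radon-Nikodym property *)

Section measure_sequences.
Context (R : realType) (d : measure_display) (T : measurableType d).
Context (mu : {finite_measure set T -> \bar R}).
Local Notation m := (rmeasure mu).
Implicit Types A B E F : set T.

Definition symdiff A B := (A `\` B) `|` (B `\` A).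

Lemma measurable_symdiff A B :
  measurable A -> measurable B -> measurable (symdiff A B).
Proof. by move=> mA mB; apply: measurableU; exact: measurableD. Qed.

Lemma symdiffC A B : symdiff A B = symdiff B A.
Proof. by rewrite /symdiff setUC. Qed.

Lemma rmeasure_le_symdiff A B : measurable A -> measurable B ->
  m A <= m B + m (symdiff A B).
Proof.
move=> mA mB; have mAB := measurable_symdiff mA mB.
rewrite (le_trans _ (rmeasureU_le _ mB mAB))//; apply: le_rmeasure => //.
  exact: measurableU.
by move=> t At; have [|nB] := pselect (B t); [left|right; left].
Qed.

Lemma rmeasure_dist_symdiff A B : measurable A -> measurable B ->
  `|m A - m B| <= m (symdiff A B).
Proof.
move=> mA mB; rewrite ler_norml; apply/andP; split.
  rewrite lerNl opprB lerBlDr addrC symdiffC; exact: rmeasure_le_symdiff.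
by rewrite lerBlDr addrC; exact: rmeasure_le_symdiff.
Qed.

Lemma rmeasure_bigsetU_le (I : Type) (s : seq I) (F : I -> set T) :
  (forall i, measurable (F i)) ->
  measurable (\big[setU/set0]_(i <- s) F i) /\
  m (\big[setU/set0]_(i <- s) F i) <= \sum_(i <- s) m (F i).
Proof.
move=> mF; elim: s => [|i s [mU IH]].
  by rewrite !big_nil rmeasure0; split.
rewrite !big_cons; split; first exact: measurableU.
by rewrite (le_trans (rmeasureU_le _ (mF i) mU))// lerD2l.
Qed.

Lemma integral_pairwise_disjoint (N : eqType) (I : N -> set T) (s : seq N)
    (h : T -> R) :
  (forall p, measurable (I p)) -> measurable_fun setT h -> (forall t, 0 <= h t) ->
  pairwise (fun p q => `[< I p `&` I q = set0 >]) s ->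
  (\sum_(p <- s) \int[mu]_(t in I p) (h t)%:E <= \int[mu]_t (h t)%:E)%E.
Proof.
move=> mI mh h0 ds.
have mhE E : measurable_fun E (EFin \o h).
  by apply/measurable_EFinP; exact: measurable_funTS.
apply: (@le_trans _ _ (\int[mu]_(t in \big[setU/set0]_(p <- s) I p) (h t)%:E)%E);
    last first.
  apply: ge0_subset_integral => //; first by have [] := rmeasure_bigsetU_le s mI.
  by move=> t _; rewrite lee_fin.
elim: s ds => [|p s IH]; first by rewrite !big_nil integral_set0.
rewrite pairwise_cons => /andP[/allP pd /IH {}IH]; rewrite !big_cons.
rewrite ge0_integral_setU//.
- by rewrite leeD2l.
- by have [] := rmeasure_bigsetU_le s mI.
- by move=> t _; rewrite lee_fin.
- rewrite disj_set2E; apply/eqP/seteqP; split=> //.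
  elim: s pd {IH} => [_|q s IH pd]; first by rewrite big_nil setI0.
  rewrite big_cons setIUr => t [|].
    by have /asboolP -> := pd q (mem_head _ _).
  by apply: IH => r rs; apply: pd; rewrite inE rs orbT.
Qed.

End measure_sequences.

Lemma rnorm_cauchy_cvg (R : realType) (k : scalar_kind)
    (X : completeNormedModType (scalar_field R k)) (u : nat -> X) :
  (forall e : R, 0 < e ->
    exists n, forall i j, (n <= i)%N -> (n <= j)%N -> rnorm (u i - u j) < e) ->
  cvgn u.
Proof.
move=> cu; apply/cauchy_cvgP/cauchy_exP => e e0.
have eE : of_real k (re e) = e by rewrite reK// gtr0_real.
have [|n nu] := cu (re e); first by rewrite -(ltr_of_real k) of_real0 eE.
exists (u n); exists n => //= i /= ni.
by rewrite /= -ball_normE /ball_ /= -eE -rnormE ltr_of_real nu.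
Qed.

Section martingale.
Context (R : realType) (k : scalar_kind).
Context (X : completeNormedModType (scalar_field R k)).
Context (d : measure_display) (T : measurableType d).
Context (mu : {finite_measure set T -> \bar R}).
Local Notation m := (rmeasure mu).
(** A martingale presented as a tree: on the atom [I p] of a node p in [lev n], the n-th term has
    the value [v p]. The hypothesis [gen] states, as an induction principle, that the atoms generate
    the measurable sets. *)
Context (N : eqType) (lev : nat -> seq N) (kids : N -> seq N).
Context (I : N -> set T) (v : N -> X).
Context (levS : forall n, lev n.+1 = flatten [seq kids p | p <- lev n])
  (mI : forall p, measurable (I p))
  (v1 : forall n p, p \in lev n -> rnorm (v p) <= 1)
  (cover : forall n E, measurable E -> \sum_(p <- lev n) m (E `&` I p) = m E)
  (kidsI : forall n p q, p \in lev n -> q \in kids p -> I q `<=` I p)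
  (mass : forall n p, p \in lev n -> \sum_(q <- kids p) m (I q) = m (I p))
  (barycenter : forall n p, p \in lev n ->
    \sum_(q <- kids p) of_real k (m (I q)) *: v q = of_real k (m (I p)) *: v p)
  (disj : forall n, pairwise (fun p q => `[< I p `&` I q = set0 >]) (lev n))
  (gen : forall P : set (set T), sigma_algebra setT P ->
    (forall n p, p \in lev n -> P (I p)) -> measurable `<=` P).
Implicit Types (E A B : set T) (n : nat) (p q : N).

Lemma lev_kids n p q : p \in lev n -> q \in kids p -> q \in lev n.+1.
Proof.
by move=> pl qp; rewrite levS; apply/flattenP; exists (kids p) => //; exact: map_f.
Qed.

Lemma lev_parent n q : q \in lev n.+1 -> exists2 p, p \in lev n & q \in kids p.
Proof. by rewrite levS => /flattenP[_ /mapP[p pl ->] qp]; exists p. Qed.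

Lemma sum_lev n (f : N -> R) :
  \sum_(q <- lev n.+1) f q = \sum_(p <- lev n) \sum_(q <- kids p) f q.
Proof. by rewrite levS big_flatten big_map. Qed.

Lemma lev_eq_or_disjoint n p q : p \in lev n -> q \in lev n ->
  p = q \/ I p `&` I q = set0.
Proof.
elim: (lev n) (disj n) => // r s IH; rewrite pairwise_cons => /andP[/allP rs /IH {}IH].
rewrite !inE => /predU1P[->|ps] /predU1P[->|qs]; first by left.
- by right; exact/asboolP/rs.
- by right; rewrite setIC; exact/asboolP/rs.
- exact: IH.
Qed.

(** Measurability at level n, up to the points that lie in no atom, which form a null set by
    [cover]. *)
Definition adapted n A :=
  measurable A /\ forall p, p \in lev n -> I p `<=` A \/ I p `&` A = set0.

Lemma adaptedS n A : adapted n A -> adapted n.+1 A.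
Proof.
move=> [mA aA]; split=> // q /lev_parent[p pl qp].
have qI := kidsI pl qp; have [pA|pA] := aA _ pl; [left|right].
  exact: subset_trans pA.
by apply/seteqP; split=> // t [/qI pt At]; rewrite -pA.
Qed.

Lemma adapted_leq n j A : (n <= j)%N -> adapted n A -> adapted j A.
Proof.
by move=> /subnKC <-; elim: (j - n)%N => [|i IH]; rewrite ?addn0// addnS
  => /IH/adaptedS.
Qed.

Lemma adaptedI n p : p \in lev n -> adapted n (I p).
Proof.
move=> pl; split=> // q ql; have [->|] := lev_eq_or_disjoint ql pl; first by left.
by right.
Qed.

Lemma adaptedC n A : adapted n A -> adapted n (~` A).
Proof.
move=> [mA aA]; split; first exact: measurableC.
move=> p /aA[pA|pA]; [right|left].
  by apply/seteqP; split=> // t [/pA].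
by apply/disj_setPLR/eqP.
Qed.

Lemma adaptedU n A B : adapted n A -> adapted n B -> adapted n (A `|` B).
Proof.
move=> [mA aA] [mB aB]; split; first exact: measurableU.
move=> p pl; have [pA|pA] := aA p pl; first by left=> t /pA; left.
have [pB|pB] := aB p pl; first by left=> t /pB; right.
by right; rewrite setIUr pA pB setU0.
Qed.

Lemma adapted0 n : adapted n set0.
Proof. by split=> // p _; right; rewrite setI0. Qed.

(** The sets approximable in measure by adapted ones form a sigma-algebra that contains the atoms,
    so [gen] applies. A countable union is first cut to a finite one. *)
Lemma adapted_approx E (e : R) : measurable E -> 0 < e ->
  exists n A, adapted n A /\ m (symdiff E A) < e.
Proof.
pose P E := measurable E /\
  forall e : R, 0 < e -> exists n A, adapted n A /\ m (symdiff E A) < e.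
suff : measurable `<=` P by move=> mP /mP[_] + e0 => /(_ _ e0).
have P0 : P set0.
  split=> // e' e'0; exists 0%N, set0; split; first exact: adapted0.
  by rewrite /symdiff setD0 setU0 rmeasure0.
have PU A B : P A -> P B -> P (A `|` B).
  move=> [mA aA] [mB aB]; split; first exact: measurableU.
  move=> e' e'0; have e2 : 0 < e' / 2 by rewrite divr_gt0.
  have [n [A' [aA' A'e]]] := aA _ e2; have [j [B' [aB' B'e]]] := aB _ e2.
  exists (maxn n j), (A' `|` B').
  have aU : adapted (maxn n j) (A' `|` B').
    apply: adaptedU; [apply: adapted_leq aA'|apply: adapted_leq aB'].
      exact: leq_maxl.
    exact: leq_maxr.
  split=> //; rewrite [e']splitr (le_lt_trans _ (ltrD A'e B'e))//.
  have [mA' _] := aA'; have [mB' _] := aB'.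
  have mAA' := measurable_symdiff mA mA'; have mBB' := measurable_symdiff mB mB'.
  rewrite (le_trans _ (rmeasureU_le _ mAA' mBB'))//; apply: le_rmeasure.
  - by apply: measurable_symdiff; [exact: measurableU|exact: aU.1].
  - exact: measurableU.
  - move=> t [[[At|Bt] /not_orP[nA nB]]|[[At|Bt] /not_orP[nA nB]]].
    + by left; left.
    + by right; left.
    + by left; right.
    + by right; right.
apply: gen; first split=> //.
- move=> A [mA aA]; rewrite setTD; split; first exact: measurableC.
  move=> e' /aA[n [B [aB Be]]]; exists n, (~` B); split; first exact: adaptedC.
  by rewrite (_ : symdiff _ _ = symdiff A B)// /symdiff !setDE !setCK setUC
    [~` A `&` _]setIC [~` B `&` _]setIC.
- move=> F PF; have mF i : measurable (F i) by have [] := PF i.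
  have mUF : measurable (\bigcup_i F i) by exact: bigcup_measurable.
  split=> // e' e'0; have e2 : 0 < e' / 2 by rewrite divr_gt0.
  have [n /= nF] : exists n,
      m ((\bigcup_i F i) `\` \big[setU/set0]_(i < n) F i) < e' / 2.
    near \oo => n; exists n; near: n; exact: rmeasure_tail.
  set U := \big[setU/set0]_(i < n) F i in nF.
  have [mU aU] : P U.
    rewrite /U; elim: (n) => [|i IH]; first by rewrite big_ord0.
    by rewrite big_ord_recr/=; exact: PU.
  have [j [A [aA Ae]]] := aU _ e2; exists j, A; split=> //.
  have [mA _] := aA; have mUA := measurable_symdiff mU mA.
  have mUU : measurable ((\bigcup_i F i) `\` U) by exact: measurableD.
  rewrite [e']splitr (le_lt_trans _ (ltrD nF Ae))//.
  rewrite (le_trans _ (rmeasureU_le _ mUU mUA))//; apply: le_rmeasure.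
  - exact: measurable_symdiff.
  - exact: measurableU.
  - move=> t [[Ft nA]|[At nF']].
      by have [Ut|nU] := pselect (U t); [right; left|left].
    right; right; split=> //; apply: contra_not nF'.
    by rewrite /U -bigcup_mkord => -[i _ Fi]; exists i.
- move=> n p pl; split=> // e' e'0; exists n, (I p); split; first exact: adaptedI.
  by rewrite /symdiff setDv setU0 rmeasure0.
Unshelve. all: by end_near. Qed.

(** The integral over E of the n-th term of the martingale. *)
Definition nu_ n E : X := \sum_(p <- lev n) of_real k (m (E `&` I p)) *: v p.

Lemma nu_dist n E A : measurable E -> measurable A ->
  rnorm (nu_ n E - nu_ n A) <= m (symdiff E A).
Proof.
move=> mE mA; have mD := measurable_symdiff mE mA.
rewrite /nu_ -sumrB (le_trans (rnorm_sum _ _ _))// -(cover n mD).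
rewrite big_seq [leRHS]big_seq; apply: ler_sum => p pl.
rewrite -scalerBl -of_realB rnorm_real.
rewrite (le_trans (ler_piMr _ (v1 pl)))//.
have mEp : measurable (E `&` I p) by exact: measurableI.
have mAp : measurable (A `&` I p) by exact: measurableI.
rewrite (le_trans (rmeasure_dist_symdiff _ mEp mAp))//; apply: le_rmeasure.
- exact: measurable_symdiff.
- exact: measurableI.
- move=> t [[[Et It] nA]|[[At It] nE]]; split=> //.
    by left; split=> // At; apply: nA.
  by right; split=> // Et; apply: nE.
Qed.

Lemma nu_U n A B : measurable A -> measurable B -> A `&` B = set0 ->
  nu_ n (A `|` B) = nu_ n A + nu_ n B.
Proof.
move=> mA mB AB; rewrite /nu_ -big_split/=; apply: eq_bigr => p _.
rewrite -scalerDl -of_realD setIUl rmeasureU//.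
- exact: measurableI.
- exact: measurableI.
- by rewrite setIACA AB set0I.
Qed.

Lemma nu_le n E : measurable E -> rnorm (nu_ n E) <= m E.
Proof.
move=> mE; rewrite /nu_ (le_trans (rnorm_sum _ _ _))// -(cover n mE).
rewrite big_seq [leRHS]big_seq; apply: ler_sum => p pl.
by rewrite rnorm_real ger0_norm ?rmeasure_ge0// ler_piMr ?rmeasure_ge0 ?(v1 pl).
Qed.

Lemma nu_adaptedS n A : adapted n A -> nu_ n.+1 A = nu_ n A.
Proof.
move=> [mA aA]; rewrite /nu_ levS big_flatten big_map big_seq [RHS]big_seq.
apply: eq_bigr => p pl; have [pA|pA] := aA _ pl.
  rewrite (setIidr pA) -(barycenter pl) big_seq [RHS]big_seq; apply: eq_bigr => q qp.
  by rewrite (setIidr (subset_trans (kidsI pl qp) pA)).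
rewrite setIC pA rmeasure0 of_real0 scale0r big_seq big1// => q qp.
rewrite (_ : A `&` I q = set0) ?rmeasure0 ?of_real0 ?scale0r//.
by apply/seteqP; split=> // t [At /(kidsI pl qp) It]; rewrite -pA.
Qed.

Lemma nu_adapted n j A : (n <= j)%N -> adapted n A -> nu_ j A = nu_ n A.
Proof.
move=> /subnKC <- aA; elim: (j - n)%N => [|i IH]; first by rewrite addn0.
by rewrite addnS nu_adaptedS//; apply: adapted_leq aA; exact: leq_addr.
Qed.

(** On an adapted set the sequence is eventually constant by the martingale property. The estimate
    [nu_dist] is uniform in n, so approximation by adapted sets makes the sequence Cauchy for every
    measurable E. *)
Lemma nu_cvg E : measurable E -> cvgn (fun n => nu_ n E).
Proof.
move=> mE; apply: rnorm_cauchy_cvg => e e0.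
have e2 : 0 < e / 2 by rewrite divr_gt0.
have [n [A [aA Ae]]] := adapted_approx mE e2; exists n => i j ni nj.
have mA := aA.1.
rewrite (le_lt_trans (rnorm_dist_triangle _ (nu_ n A) _))// [e]splitr ltrD//.
  by rewrite -(nu_adapted ni aA) (le_lt_trans (nu_dist _ mE mA)).
by rewrite rnorm_distC -(nu_adapted nj aA) (le_lt_trans (nu_dist _ mE mA)).
Qed.

Definition nu E : X := lim (nu_ n E @[n --> \oo]).

Lemma nuE n A : adapted n A -> nu A = nu_ n A.
Proof.
move=> aA; apply/cvg_lim => //; apply/cvg_rnormP => e e0.
exists n => // j /= nj; rewrite (nu_adapted nj aA) subrr rnorm0//.
Qed.

Lemma nu_norm_le E : measurable E -> rnorm (nu E) <= m E.
Proof.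
move=> mE; apply/ler_addgt0Pr => e e0.
have /cvg_rnormP/(_ _ e0)[n _ /(_ n (leqnn n))/= nue] := nu_cvg mE.
have -> : nu E = (nu E - nu_ n E) + nu_ n E by rewrite subrK.
by rewrite (le_trans (rnormD _ _))// addrC lerD ?nu_le// ltW.
Qed.

Lemma nu_additive A B : measurable A -> measurable B -> A `&` B = set0 ->
  nu (A `|` B) = nu A + nu B.
Proof.
move=> mA mB AB; apply/cvg_lim => //.
under eq_fun do rewrite nu_U//.
by apply: cvgD; exact: nu_cvg.
Qed.

Lemma nu_bigsetU (F : (set T)^nat) n : (forall i, measurable (F i)) ->
  trivIset setT F ->
  nu (\big[setU/set0]_(i < n) F i) = \sum_(i < n) nu (F i).
Proof.
move=> mF tF; elim: n => [|n IH].
  rewrite !big_ord0; apply/eqP; rewrite -rnorm_eq0; apply/eqP/le_anti.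
  by rewrite rnorm_ge0 andbT (le_trans (nu_norm_le _))// rmeasure0.
rewrite !big_ord_recr/= nu_additive ?IH//; first exact: bigsetU_measurable.
rewrite -bigcup_mkord; apply/seteqP; split=> // t [[i /= ni Fi] Fn].
have : i = n by apply: tF => //; exists t.
by move=> ein; rewrite ein ltnn in ni.
Qed.

Lemma nu_vector_measure : vector_measure nu.
Proof.
move=> F mF tF; apply/cvg_rnormP => e e0.
have mU : measurable (\bigcup_i F i) by exact: bigcup_measurable.
apply: filterS (rmeasure_tail mu mF e0) => n; apply: le_lt_trans.
have mUn : measurable (\big[setU/set0]_(i < n) F i) by exact: bigsetU_measurable.
have UF : \bigcup_i F i = \big[setU/set0]_(i < n) F i `|`
    ((\bigcup_i F i) `\` \big[setU/set0]_(i < n) F i).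
  rewrite setDUK// -bigcup_mkord => t [i _ Fi]; by exists i.
rewrite -nu_bigsetU// {1}UF nu_additive//.
- by rewrite addrAC subrr add0r; apply: nu_norm_le; exact: measurableD.
- exact: measurableD.
- by rewrite setDIK.
Qed.

Lemma nu_bounded_variation : Defs.bounded_variation nu.
Proof.
exists (m setT) => n F mF tF _.
apply: (@le_trans _ _ (\sum_(i < n) m (F i))); first by
  apply: ler_sum => i _; exact: nu_norm_le.
have tFE i j : i != j -> F i `&` F j = set0 by move/trivIsetP: tF => /(_ i j Logic.I Logic.I).
have : forall s : seq 'I_n, uniq s ->
    \sum_(i <- s) m (F i) = m (\big[setU/set0]_(i <- s) F i).
  elim=> [|i s IH]; first by rewrite !big_nil rmeasure0.
  move=> /= /andP[is_ /IH {}IH]; rewrite !big_cons IH rmeasureU//.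
    by have [] := rmeasure_bigsetU_le mu s mF.
  rewrite big_distrr/= big_seq big1// => j js; rewrite tFE//.
  by apply: contraNneq is_ => ->.
move=> /(_ _ (index_enum_uniq _)) ->; apply: le_rmeasure => //.
by have [] := rmeasure_bigsetU_le mu (index_enum 'I_n) mF.
Qed.

Lemma nu_abs_continuous : Defs.abs_continuous mu nu.
Proof.
move=> e e0; exists e => // E mE Ee.
by rewrite (le_lt_trans (nu_norm_le mE))// -lte_fin rmeasureE.
Qed.

Lemma nu_atom n q : q \in lev n -> nu (I q) = of_real k (m (I q)) *: v q.
Proof.
move=> ql; rewrite (nuE (adaptedI ql)); apply/eqP; rewrite -subr_eq0 -rnorm_eq0.
apply/eqP/le_anti; rewrite rnorm_ge0 andbT /nu_ -{1}(cover n (mI q)).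
rewrite (big_morph (of_real k) (@of_realD R k) (of_real0 R k)) scaler_suml -sumrB.
rewrite (le_trans (rnorm_sum _ _ _))// big_seq big1// => p pl.
rewrite -scalerBr; have [->|pq] := lev_eq_or_disjoint pl ql.
  by rewrite subrr scaler0 rnorm0.
by rewrite setIC pq rmeasure0 of_real0 scale0r rnorm0.
Qed.

(* By the Radon-Nikodym property nu has a density, which is close in L^1 to a
   simple function, which in turn is close to one that is constant on the
   atoms of some level n; v is then nearly constant on the children of most
   atoms of that level. *)
Theorem rnp_martingale (e : R) : radon_nikodym_property X -> 0 < e ->
  exists n,
    \sum_(p <- lev n) \sum_(q <- kids p) m (I q) * rnorm (v q - v p) < e.
Proof.
move=> rnp e0.
have [g gnu] := rnp _ _ mu nu nu_vector_measure nu_bounded_variation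
  nu_abs_continuous.
have e6 : 0 < e / 6 by rewrite divr_gt0.
have [s [h [fs mh h0 he hnu]]] := bochner_control e6 gnu.
have [r ur sr] := finite_range_seq fs.
pose M := \sum_(x <- r) rnorm x.
have M0 : 0 <= M by apply: sumr_ge0 => x _; exact: rnorm_ge0.
have rM x : x \in r -> rnorm x <= M.
  move=> xr; rewrite /M (bigD1_seq x)//= lerDl; apply: sumr_ge0 => y _.
  exact: rnorm_ge0.
(* The exceptional set B below has measure at most (size r) c, and c is chosen to make its
   contribution 2 M (size r) c at most e / 6. *)
pose D := 1 + 2 * M * (1 + (size r)%:R); pose c : R := (e / 6) / D.
have den0 : 0 < D.
  by rewrite ltr_wpDr// !mulr_ge0// addr_ge0.
have c0 : 0 < c by rewrite divr_gt0.
have [_ ms] := fs.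
have /choice[nA nAP] x : exists nA : nat * set T,
    adapted nA.1 nA.2 /\ m (symdiff (s @^-1` [set x]) nA.2) < c.
  by have [j [A AP]] := adapted_approx (ms x) c0; exists (j, A).
pose n := \max_(x <- r) (nA x).1; exists n; pose A x := (nA x).2.
have aA x : x \in r -> adapted n (A x).
  move=> xr; apply: adapted_leq (nAP x).1; rewrite /n.
  exact: (@leq_bigmax_seq _ r xpredT (fun x => (nA x).1)).
pose S x := symdiff (s @^-1` [set x]) (A x).
have mA x : measurable (A x) by have [[]] := nAP x.
have mS x : measurable (S x) by exact: measurable_symdiff.
pose B := \big[setU/set0]_(x <- r) S x.
have [mB Bc] : measurable B /\ m B <= (size r)%:R * c.
  have [mB Bs] := rmeasure_bigsetU_le mu r mS; split=> //.
  rewrite (le_trans Bs)// mulr_natl -iter_addr_0 -count_predT -big_const_seq.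
  by apply: ler_sum => x _; apply: ltW; have [] := nAP x.
have SB x : x \in r -> S x `<=` B.
  by move=> xr t St; rewrite /B (big_rem x xr)/=; left.
(* z p is the value of s on the atom of p off B. An atom contained in no [A x] lies entirely in B,
   and then 0 serves. *)
have /choice[z zP] p : exists z : X, p \in lev n -> rnorm z <= M /\
    forall t, I p t -> s t <> z -> B t.
  have [pl|] := boolP (p \in lev n); last by exists 0.
  have [[x xr pA]|nx] := pselect (exists2 x, x \in r & I p `<=` A x).
    exists x => _; split=> [|t pt sx]; first exact: rM.
    by apply: (SB x xr); right; split; [exact: pA|].
  exists 0 => _; split=> [|t pt _]; first by rewrite rnorm0.
  apply: (SB (s t) (sr t)); left; split=> // At.
  have [pA|pA] := (aA _ (sr t)).2 p pl; first by apply: nx; exists (s t).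
  by have : (I p `&` A (s t)) t by []; rewrite pA.
have atom p q : p \in lev n -> q \in kids p ->
    rnorm (simple_integral mu (I q) s - of_real k (m (I q)) *: z p) <=
    2 * M * m (B `&` I q).
  move=> pl qp; have [zM zB] := zP p pl.
  have cov F : measurable F -> m F = \sum_(x <- r) m (F `&` s @^-1` [set x]).
    move=> mF; rewrite -rmeasure_sum_fibers//; congr (fine (mu _)).
    by apply/seteqP; split=> [t Ft|t []//]; split=> //=.
  rewrite (simple_integralE mu id fs ur sr (mI q)) (cov _ (mI q)).
  rewrite (big_morph (of_real k) (@of_realD R k) (of_real0 R k)) scaler_suml -sumrB.
  rewrite (le_trans (rnorm_sum _ _ _))// (cov _ (measurableI _ _ mB (mI q))).
  rewrite mulr_sumr big_seq [leRHS]big_seq; apply: ler_sum => x xr.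
  rewrite -scalerBr rnorm_real ger0_norm ?rmeasure_ge0// mulrC.
  have [->|xz] := eqVneq x (z p).
    by rewrite subrr rnorm0 mul0r !mulr_ge0 ?rmeasure_ge0.
  rewrite ler_pM ?rnorm_ge0 ?rmeasure_ge0//.
    by rewrite (le_trans (rnormB _ _))// mulr_natl mulr2n lerD// rM.
  apply: le_rmeasure.
  - exact: measurableI.
  - by apply: measurableI => //; exact: measurableI.
  - move=> t [qt /= sx]; split=> //; split=> //; apply: zB.
      exact: (kidsI pl qp).
    by rewrite sx; exact/eqP.
have hfin q : (\int[mu]_(t in I q) (h t)%:E)%E \is a fin_num.
  rewrite ge0_fin_numE; last by apply: integral_ge0 => t _; rewrite lee_fin.
  apply: le_lt_trans (ltry (e / 6)); apply: le_trans he.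
  apply: ge0_subset_integral => //; last by move=> t _; rewrite lee_fin.
  exact/measurable_EFinP.
pose a p q := rnorm (of_real k (m (I q)) *: (v q - z p)).
have aP p q : p \in lev n -> q \in kids p ->
    a p q <= fine (\int[mu]_(t in I q) (h t)%:E) + 2 * M * m (B `&` I q).
  move=> pl qp; have ql := lev_kids pl qp.
  rewrite /a scalerBr -(nu_atom ql).
  rewrite (le_trans (rnorm_dist_triangle _ (simple_integral mu (I q) s) _))//.
  by rewrite lerD ?atom// -lee_fin fineK ?hnu.
have sum_a : \sum_(p <- lev n) \sum_(q <- kids p) a p q <= e / 3.
  apply: (@le_trans _ _ (\sum_(q <- lev n.+1)
      (fine (\int[mu]_(t in I q) (h t)%:E) + 2 * M * m (B `&` I q)))).
    rewrite sum_lev big_seq [leRHS]big_seq; apply: ler_sum => p pl.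
    by rewrite big_seq [leRHS]big_seq; apply: ler_sum => q; exact: aP.
  rewrite big_split/= -mulr_sumr cover//.
  have : \sum_(q <- lev n.+1) fine (\int[mu]_(t in I q) (h t)%:E) <= e / 6.
    rewrite -lee_fin (le_trans _ he)// -sumEFin.
    under eq_bigr do rewrite fineK//.
    exact: integral_pairwise_disjoint.
  have : 2 * M * m B <= e / 6.
    rewrite (le_trans (ler_wpM2l _ Bc)) ?mulr_ge0//.
    have -> : 2 * M * ((size r)%:R * c) = e / 6 * (2 * M * (size r)%:R / D).
      by rewrite /c; move: (e / 6) D^-1 => x y; ring.
    rewrite ler_piMr ?(ltW e6)// ler_pdivrMr// mul1r /D.
    have : 0 <= 2 * M by rewrite mulr_ge0.
    by rewrite mulrDr mulr1; lra.
  by lra.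
rewrite (@le_lt_trans _ _ (2 * (e / 3)))//; last by lra.
rewrite (le_trans _ (ler_wpM2l _ sum_a))// mulr_sumr big_seq [leRHS]big_seq.
apply: ler_sum => p pl.
(* The vector z p is only a reference point. As v p is the barycenter of the v q, its distance to z
   p is controlled by the same sum, which costs the factor 2 above. *)
have pa : m (I p) * rnorm (v p - z p) <= \sum_(q <- kids p) a p q.
  rewrite -[m (I p)]ger0_norm ?rmeasure_ge0// -rnorm_real scalerBr.
  rewrite -(barycenter pl) -(mass pl).
  rewrite (big_morph (of_real k) (@of_realD R k) (of_real0 R k)) scaler_suml -sumrB.
  rewrite (le_trans (rnorm_sum _ _ _))//; apply: ler_sum => q _.
  by rewrite -scalerBr.
rewrite mulr_natl mulr2n (le_trans _ (lerD (lexx _) pa))//.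
rewrite -(mass pl) mulr_suml -big_split/=; apply: ler_sum => q _.
rewrite /a rnorm_real ger0_norm ?rmeasure_ge0// -mulrDr.
rewrite ler_wpM2l ?rmeasure_ge0//.
by rewrite (le_trans (rnorm_dist_triangle _ (z p) _))// lerD2l rnorm_distC.
Qed.

End martingale.

Section lebesgue_on_generated.
Context (R : realType) (G : set (set R)) (GB : G `<=` measurable).
Local Notation T := (g_sigma_algebraType G).

Let U : set R := `[0, 1[%classic.

Let mU : measurable U.
Proof. exact: measurable_itv. Qed.

Let mG (A : set R) : <<s G >> A -> measurable A.
Proof. by apply: smallest_sub => //; exact: sigma_algebra_measurable. Qed.

(** The measure lives on the sigma-algebra generated by [G] instead of the Borel sets: when [G]
    consists of the intervals of a tree, the hypothesis [gen] of the martingale section is then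
    immediate. *)
Definition lebesgue_on_generated of G `<=` measurable :=
  fun A : set T => lebesgue_measure ((A : set R) `&` `[0, 1[%classic).

Local Notation leb := (lebesgue_on_generated GB).

Let leb0 : leb set0 = 0%E.
Proof. by rewrite /lebesgue_on_generated set0I measure0. Qed.

Let leb_ge0 A : (0 <= leb A)%E.
Proof. exact: measure_ge0. Qed.

Let leb_sigma_additive : semi_sigma_additive leb.
Proof.
move=> F mF tF mUF; rewrite /lebesgue_on_generated setI_bigcupl.
apply: measure_sigma_additive.
  by move=> i; apply: measurableI => //; exact: mG (mF i).
apply/trivIsetP => i j _ _ ij; rewrite setIACA.
by move/trivIsetP : tF => /(_ i j I I ij) ->; rewrite set0I.
Qed.

HB.instance Definition _ := isMeasure.Build _ _ _ leb
  leb0 leb_ge0 leb_sigma_additive.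

Let leb_fin : fin_num_fun leb.
Proof.
move=> A mA; rewrite ge0_fin_numE// (@le_lt_trans _ _ (lebesgue_measure U))//.
  by apply: le_measure; rewrite ?inE//; apply: measurableI => //; exact: mG.
by rewrite /U lebesgue_measure_itv/= lte_fin ltr01 ltry.
Qed.

HB.instance Definition _ := @Measure_isFinite.Build _ T R leb leb_fin.

End lebesgue_on_generated.

Section interval_tree.
Context (R : realType) (k : scalar_kind).
Context (X : completeNormedModType (scalar_field R k)).
(** Left endpoint, length, and value in X. *)
Local Notation node := (R * R * X)%type.

Definition node_itv (p : node) : set R := `[p.1.1, p.1.1 + p.1.2[%classic.

(** Consecutive intervals tiling [a, b[. Lengths may vanish, so zero weights of a convex combination
    need not be discarded. *)
Fixpoint chain (a b : R) (s : seq node) : Prop :=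
  if s is p :: s' then [/\ p.1.1 = a, 0 <= p.1.2 & chain (a + p.1.2) b s']
  else a = b.

Lemma chain_cat a b c s s' : chain a b s -> chain b c s' -> chain a c (s ++ s').
Proof.
elim: s a => [a /= -> //|p s IH a /= [pa p0 ch] ch']; split=> //.
exact: IH.
Qed.

Lemma chain_le a b s : chain a b s -> a <= b.
Proof.
elim: s a => [a /= ->//|p s IH a /= [_ p0 /IH]]; apply: le_trans.
by rewrite lerDl.
Qed.

Lemma chain_mem a b s p : chain a b s -> p \in s ->
  [/\ a <= p.1.1, 0 <= p.1.2 & p.1.1 + p.1.2 <= b].
Proof.
elim: s a => // q s IH a /= [qa q0 ch]; rewrite inE => /predU1P[->|ps].
  by split; rewrite ?qa//; exact: chain_le ch.
have [ap p0 pb] := IH _ ch ps; split=> //; apply: le_trans ap.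
by rewrite lerDl.
Qed.

Lemma chain_bigsetU a b s : chain a b s ->
  \big[setU/set0]_(p <- s) node_itv p = `[a, b[%classic.
Proof.
elim: s a => [a /= ->|p s IH a /= [pa p0 ch]].
  by rewrite big_nil set_itvco0.
rewrite big_cons (IH _ ch) /node_itv pa; apply/seteqP; split=> t /=;
  rewrite !in_itv/=.
  have := chain_le ch.
  by move=> ab [/andP[at_ ta]|/andP[at_ ta]]; apply/andP; split=> //; lra.
move=> /andP[at_ tb]; have [ta|ta] := ltP t (a + p.1.2); [left|right].
  exact/andP.
exact/andP.
Qed.

Lemma chain_pairwise a b s : chain a b s ->
  pairwise (fun p q => `[< node_itv p `&` node_itv q = set0 >]) s.
Proof.
elim: s a => // p s IH a /= [pa p0 ch]; rewrite (IH _ ch) andbT; apply/allP => q qs.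
apply/asboolP/seteqP; split=> // t []; rewrite /node_itv /= !in_itv/= pa.
have [qa _ _] := chain_mem ch qs.
by move=> /andP[_ ta] /andP[qt _]; lra.
Qed.

Fixpoint split_node (a l : R) (s : seq (R * X)) : seq node :=
  if s is c :: s' then (a, l * c.1, c.2) :: split_node (a + l * c.1) l s'
  else [::].

Definition node_data (p : node) : R * X := (p.1.2, p.2).

Lemma split_node_data a l s :
  [seq node_data p | p <- split_node a l s] = [seq (l * c.1, c.2) | c <- s].
Proof. by elim: s a => //= c s IH a; rewrite IH. Qed.

Lemma split_node_chain a l s : 0 <= l -> (forall c, c \in s -> 0 <= c.1) ->
  chain a (a + l * \sum_(c <- s) c.1) (split_node a l s).
Proof.
move=> l0; elim: s a => [a _ /=|c s IH a cs /=]; first by rewrite big_nil mulr0 addr0.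
split=> //; first by rewrite mulr_ge0// cs// mem_head.
rewrite big_cons mulrDr addrA; apply: IH => c' c's.
by apply: cs; rewrite inE c's orbT.
Qed.

Context (ch : X -> seq (R * X)) (x0 : X).
Context (x01 : rnorm x0 <= 1).
Context (ch_ge0 : forall x c, rnorm x <= 1 -> c \in ch x ->
    0 <= c.1 /\ rnorm c.2 <= 1)
  (ch_sum : forall x, rnorm x <= 1 -> \sum_(c <- ch x) c.1 = 1)
  (ch_bary : forall x, rnorm x <= 1 ->
    \sum_(c <- ch x) of_real k c.1 *: c.2 = x).

(** The levels of the tree without the positions of the intervals: the weight of a branch, which is
    the length of its interval, and the value at its end. *)
Fixpoint tree_level (n : nat) : seq (R * X) :=
  if n is n'.+1 then
    flatten [seq [seq (p.1 * c.1, c.2) | c <- ch p.2] | p <- tree_level n']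
  else [:: (1, x0)].

Let kids (p : node) : seq node := split_node p.1.1 p.1.2 (ch p.2).

Let lev (n : nat) : seq node :=
  iter n (fun s => flatten [seq kids p | p <- s]) [:: (0, 1, x0)].

Let lev_data n : [seq node_data p | p <- lev n] = tree_level n.
Proof.
elim: n => //= n <-; rewrite map_flatten -!map_comp; congr flatten.
by apply: eq_map => p /=; rewrite split_node_data.
Qed.

Let lev_chain n : chain 0 1 (lev n) /\ forall p, p \in lev n -> rnorm p.2 <= 1.
Proof.
elim: n => [|n [IHc IHn]].
  split=> [|p]; first by split=> //=; rewrite add0r.
  by rewrite inE => /eqP ->.
rewrite [lev _]/(flatten [seq kids p | p <- lev n]).
split; last first.
  move=> q /flattenP[_ /mapP[p /IHn p1 ->] qp].
  have : node_data q \in [seq node_data p | p <- kids p] by exact: map_f.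
  rewrite split_node_data => /mapP[c cp [_ ->]].
  by have [] := ch_ge0 p1 cp.
elim: (lev n) (0 : R) IHc IHn => //= p s IH a [pa p0 ps] IHn.
apply: (@chain_cat _ (a + p.1.2)).
  have p1 : rnorm p.2 <= 1 by apply: IHn; rewrite mem_head.
  have := @split_node_chain p.1.1 p.1.2 (ch p.2) p0.
  rewrite /kids ch_sum// mulr1 pa; apply => c cp.
  by have [] := ch_ge0 p1 cp.
by apply: IH => // q qs; apply: IHn; rewrite inE qs orbT.
Qed.

Lemma bush_martingale (e : R) : radon_nikodym_property X -> 0 < e ->
  exists n, \sum_(p <- tree_level n) \sum_(c <- ch p.2)
    p.1 * c.1 * rnorm (c.2 - p.2) < e.
Proof.
move=> rnp e0; pose G := [set A : set R | exists n p, p \in lev n /\ A = node_itv p].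
have GB : G `<=` measurable by move=> _ [n [p [_ ->]]]; exact: measurable_itv.
pose mu : {finite_measure set (g_sigma_algebraType G) -> \bar R} :=
  lebesgue_on_generated GB.
have muE A : mu A = lebesgue_measure (A `&` `[0, 1[%classic) by [].
pose T := g_sigma_algebraType G.
(* The interval of a node outside the tree need not belong to the generated sigma-algebra, hence the
   default value [set0]. *)
pose I (p : node) : set T :=
  if `[< exists n, p \in lev n >] then node_itv p else set0.
have IE n p : p \in lev n -> I p = node_itv p.
  by move=> pl; rewrite /I asboolT//; exists n.
have mI p : measurable (I p).
  rewrite /I; case: asboolP => [[n pl]|_]; last exact: measurable0.
  by apply: sub_sigma_algebra; exists n, p.
have muI n p : p \in lev n -> rmeasure mu (I p) = p.1.2.
  move=> pl; have [a0 l0 l1] := chain_mem (lev_chain n).1 pl.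
  rewrite /rmeasure muE (IE _ _ pl) (setIidl _); last first.
    move=> t; rewrite /node_itv /= !in_itv/= => /andP[at_ ta].
    by apply/andP; split; lra.
  rewrite /node_itv lebesgue_measure_itv/= lte_fin ltrDl.
  case: ltP => [_|l00]; first by rewrite -EFinD/= addrAC subrr add0r.
  by apply/le_anti; rewrite l0 l00.
have kidsl n p q : p \in lev n -> q \in kids p -> q \in lev n.+1.
  by move=> pl qp; apply/flattenP; exists (kids p) => //; exact: map_f.
have Idisj n : pairwise (fun p q => `[< I p `&` I q = set0 >]) (lev n).
  have := chain_pairwise (lev_chain n).1.
  have : {in lev n, forall p, I p = node_itv p} by move=> p; exact: IE.
  elim: (lev n) => // p s IH sI /= /andP[/allP ps sd]; apply/andP; split.
    apply/allP => q qs; rewrite !sI ?mem_head//; first exact: ps.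
    by rewrite inE qs orbT.
  by apply: IH => // q qs; apply: sI; rewrite inE qs orbT.
have cover n E : measurable E ->
    \sum_(p <- lev n) rmeasure mu (E `&` I p) = rmeasure mu E.
  move=> mE; have mU s := rmeasure_bigsetU_le mu s mI.
  have key s : pairwise (fun p q => `[< I p `&` I q = set0 >]) s ->
      \sum_(p <- s) rmeasure mu (E `&` I p) =
      rmeasure mu (E `&` \big[setU/set0]_(p <- s) I p).
    elim: s => [_|p s IH]; first by rewrite !big_nil setI0 rmeasure0.
    move=> /= /andP[/allP pd /IH {}IH]; rewrite !big_cons IH setIUr rmeasureU//.
    - exact: measurableI.
    - by apply: measurableI => //; have [] := mU s.
    - rewrite setIACA big_distrr/= big_seq big1 ?setI0// => q qs.
      exact/asboolP/pd.
  rewrite key// big_seq (eq_bigr node_itv); last by move=> p; exact: IE.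
  rewrite -big_seq (chain_bigsetU (lev_chain n).1) /rmeasure !muE.
  by rewrite -setIA setIid.
have kid_data n p (f : R -> X -> R) : p \in lev n ->
    \sum_(q <- kids p) f q.1.2 q.2 = \sum_(c <- ch p.2) f (p.1.2 * c.1) c.2.
  move=> pl; transitivity
    (\sum_(c <- [seq node_data q | q <- kids p]) f c.1 c.2); first by rewrite big_map.
  by rewrite split_node_data big_map.
have := @rnp_martingale R k X _ T mu node lev kids I (fun p => p.2) _ mI _ cover
  _ _ _ Idisj _ e rnp e0.
case=> //.
- by move=> n p pl; exact: (lev_chain n).2.
- move=> n p q pl qp; rewrite (IE _ _ pl) (IE _ _ (kidsl _ _ _ pl qp)).
  have [a0 l0 l1] := chain_mem (lev_chain n).1 pl.
  have p1 := (lev_chain n).2 _ pl.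
  have := @split_node_chain p.1.1 p.1.2 (ch p.2) l0.
  move=> /(_ (fun c cp => (ch_ge0 p1 cp).1)).
  rewrite ch_sum// mulr1 => /chain_mem/(_ qp)[qa q0 qb] t.
  rewrite /node_itv /= !in_itv/= => /andP[at_ ta].
  by apply/andP; split; lra.
- move=> n p pl; rewrite (muI n)// big_seq.
  rewrite (eq_bigr (fun q : node => q.1.2)) => [|q qp].
    rewrite -big_seq (kid_data n p (fun l _ => l))// -mulr_sumr ch_sum ?mulr1//.
    exact: (lev_chain n).2.
  by rewrite (muI n.+1)//; exact: kidsl qp.
- move=> n p pl; rewrite (muI n)// big_seq.
  rewrite (eq_bigr (fun q : node => of_real k q.1.2 *: q.2)) => [|q qp]; last first.
    by rewrite (muI n.+1)//; exact: kidsl qp.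
  rewrite -big_seq; transitivity
    (\sum_(c <- [seq node_data q | q <- kids p]) of_real k c.1 *: c.2).
    by rewrite big_map.
  rewrite split_node_data big_map/= -{2}(ch_bary ((lev_chain n).2 _ pl)) scaler_sumr.
  by apply: eq_bigr => c _; rewrite scalerA of_realM.
- move=> P sP PI; apply: smallest_sub => // _ [n [p [pl ->]]].
  by rewrite -(IE _ _ pl); exact: PI pl.
move=> n nlt; exists n; apply: le_lt_trans nlt; rewrite -lev_data big_map.
rewrite big_seq [leRHS]big_seq; apply: ler_sum => p pl.
rewrite -(kid_data n p (fun l u => l * rnorm (u - p.2)))//.
rewrite big_seq [leRHS]big_seq; apply: ler_sum => q qp.
by rewrite (muI n.+1)//; exact: kidsl qp.
Qed.

End interval_tree.

(** * Convex hulls, slices and denting points *)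

Section convex_hulls.
Context (R : realType) (k : scalar_kind) (X : normedModType (scalar_field R k)).
Implicit Types (A F : set X) (x y : X) (t : R).

Lemma convex_setP A : @convex_set (scalar_field R k) X A <-> real_convex A.
Proof.
split=> [cA t x y /andP[t0 t1] Ax Ay|cA x y l /set_mem Ax /set_mem Ay].
  have tk0 : 0 <= of_real k t by rewrite -(of_real0 R k) ler_of_real.
  have tk1 : of_real k t <= 1 by rewrite -(of_real1 R k) ler_of_real.
  have := cA x y (Itv01 tk0 tk1) (mem_set Ax) (mem_set Ay).
  by move=> /set_mem; rewrite of_realB of_real1.
apply/mem_set; have l0 : 0 <= l%:num := ge0 l.
have l1 : l%:num <= 1 := le1 l.
have lE : of_real k (re l%:num) = l%:num by rewrite reK// ger0_real.
have : 0 <= re l%:num <= 1.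
  by rewrite -!(ler_of_real k) lE of_real0 of_real1 l0 l1.
by move=> /(cA _ x y) /(_ Ax Ay); rewrite of_realB of_real1 lE.
Qed.

Lemma convex_hull_convex F : real_convex (convex_hull F).
Proof.
move=> t x y t01 Fx Fy A [cA FA].
by apply: ((convex_setP A).1 cA) => //; [exact: Fx|exact: Fy].
Qed.

Lemma sub_convex_hull F : F `<=` convex_hull F.
Proof. exact: sub_smallest. Qed.

Lemma convex_hull_sub F A : real_convex A -> F `<=` A -> convex_hull F `<=` A.
Proof. by move=> /convex_setP cA FA; exact: smallest_sub. Qed.

Lemma convex_hullS F A : F `<=` A -> convex_hull F `<=` convex_hull A.
Proof.
move=> FA; apply: convex_hull_sub; first exact: convex_hull_convex.
exact: subset_trans FA (@sub_convex_hull _).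
Qed.

Lemma convex_hull_seq F x : convex_hull F x ->
  exists s : seq (R * X), [/\ forall c, c \in s -> 0 <= c.1 /\ F c.2,
    \sum_(c <- s) c.1 = 1 & \sum_(c <- s) of_real k c.1 *: c.2 = x].
Proof.
move: x; apply: convex_hull_sub; last first.
  move=> x Fx; exists [:: (1, x)]; split=> [c||]; rewrite ?big_seq1//=.
    by rewrite inE => /eqP ->.
  by rewrite of_real1 scale1r.
move=> t x y /andP[t0 t1] [s [sF s1 <-]] [r [rF r1 <-]].
exists ([seq (t * c.1, c.2) | c <- s] ++ [seq ((1 - t) * c.1, c.2) | c <- r]).
have t1' : 0 <= 1 - t by rewrite subr_ge0.
split.
- move=> c; rewrite mem_cat => /orP[] /mapP[d dI ->] /=.
    by have [d0 Fd] := sF d dI; rewrite mulr_ge0.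
  by have [d0 Fd] := rF d dI; rewrite mulr_ge0.
- by rewrite big_cat !big_map/= -!mulr_sumr s1 r1 !mulr1 addrC subrK.
- rewrite big_cat !big_map/= !scaler_sumr; congr (_ + _);
  by apply: eq_bigr => c _; rewrite of_realM scalerA.
Qed.

Lemma convex_hull_nonempty F x : convex_hull F x -> F !=set0.
Proof.
move=> /convex_hull_seq[[|c s] [cF s1 _]]; last first.
  by exists c.2; exact: (cF c (mem_head _ _)).2.
by move: s1; rewrite big_nil => /eqP; rewrite eq_sym oner_eq0.
Qed.

Definition adherent A x := forall e : R, 0 < e -> exists2 y, A y & rnorm (x - y) < e.

Lemma adherent_convex A : real_convex A -> real_convex (adherent A).
Proof.
move=> cA t x y t01 Ax Ay e e0.
have [x' Ax' xe] := Ax e e0; have [y' Ay' ye] := Ay e e0.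
exists (of_real k t *: x' + of_real k (1 - t) *: y'); first exact: cA.
rewrite opprD addrACA -!scalerBr (le_lt_trans (rnormD _ _))//.
move: t01 => /andP[t0 t1].
rewrite !rnorm_real !ger0_norm ?subr_ge0//.
have [->|tn0] := eqVneq t 0; first by rewrite mul0r add0r subr0 mul1r.
have tx : t * rnorm (x - x') < t * e by rewrite ltr_pM2l// lt_neqAle eq_sym tn0.
have ty : (1 - t) * rnorm (y - y') <= (1 - t) * e.
  by rewrite ler_wpM2l ?subr_ge0// ltW.
by rewrite (lt_le_trans (ltr_leD tx ty))// -mulrDl addrC subrK mul1r.
Qed.

Lemma adherent_adherent A x : adherent (adherent A) x -> adherent A x.
Proof.
move=> Ax e e0; have e2 : 0 < e / 2 by rewrite divr_gt0.
have [y Ay ye] := Ax _ e2; have [z Az ze] := Ay _ e2; exists z => //.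
by rewrite (le_lt_trans (rnorm_dist_triangle _ y _))// [e]splitr ltrD.
Qed.

(** This is [separation] for the convex set x - A, which stays at a positive distance from 0. *)
Lemma separation_adherent A x : real_convex A -> A !=set0 -> ~ adherent A x ->
  exists (F : dual X) (e : R), [/\ opnorm F <= 1, 0 < e &
    forall y, A y -> re (F y) <= re (F x) - e].
Proof.
move=> cA [a Aa] nA.
have [e e0 Ae] : exists2 e : R, 0 < e & forall y, A y -> e <= rnorm (x - y).
  apply: contrapT => ne; apply: nA => e e0; apply: contrapT => nex.
  apply: ne; exists e => // y Ay; rewrite leNgt; apply/negP => xye.
  by apply: nex; exists y.
have [t _ _ t01 [y Ay <-] [z Az <-]| |_ [y Ay <-]|F F1 Fe] :=
    @separation _ _ _ [set x - y | y in A] e.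
- exists (of_real k t *: y + of_real k (1 - t) *: z); first exact: cA.
  rewrite !scalerBr addrACA -scalerDl -of_realD [t + _]addrC subrK of_real1 scale1r.
  by rewrite opprD.
- by exists (x - a), a.
- exact: Ae.
exists F, e; split=> // y Ay; have : e <= re (F (x - y)) by apply: Fe; exists y.
by rewrite linearB reB; lra.
Qed.

(** A nearly norming vector of the closed ball is shrunk a little; the open ball leaves the room
    that [bush_step] needs. *)
Lemma dual_sup (F : dual X) (t : R) : t < opnorm F ->
  exists u, rnorm u < 1 /\ t < re (F u).
Proof.
move=> tF; have [_ [u u1 <-]] := sup_gt (blin_bounded F).1 tF.
move: u1; rewrite unit_ballE => u1.
have [w w1 wF] := dual_rotate F u.
move=> tu; pose r := rnorm (F u).
have Fr s : re (F (of_real k s *: (w *: u))) = s * r.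
  by rewrite linearZ/= -[_ *: _]/(_ * _) re_of_realM wF of_realK.
have [r0|r0] := leP r 0.
  exists 0; rewrite rnorm0 linear0 re0; split=> //; exact: lt_le_trans tu r0.
have [t0|t0] := ltP t 0; first by exists 0; rewrite rnorm0 linear0 re0.
exists (of_real k ((t / r + 1) / 2) *: (w *: u)); rewrite Fr.
have tr : t / r < 1 by rewrite ltr_pdivrMr// mul1r.
have tr0 : 0 <= t / r by rewrite divr_ge0// ltW.
split; last by rewrite -ltr_pdivrMr//; lra.
rewrite rnorm_real ger0_norm; last by lra.
rewrite rnorm_torus// (@le_lt_trans _ _ ((t / r + 1) / 2))//; last by lra.
by rewrite ler_piMr//; lra.
Qed.

Lemma dual_normalize (H : dual X) : 0 < opnorm H ->
  exists2 H' : dual X, opnorm H' = 1 &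
    forall u, re (H' u) = (opnorm H)^-1 * re (H u).
Proof.
move=> h0; exists (of_real k (opnorm H)^-1 *: H) => [|u].
  rewrite -rnorm_blin rnorm_real rnorm_blin ger0_norm ?invr_ge0 ?ltW//.
  by rewrite mulVf// gt_eqF.
by rewrite blinZE -[_ *: _]/(_ * _) re_of_realM.
Qed.

Lemma convex_hull_finite A x : convex_hull A x ->
  exists2 s : seq X, (forall u, u \in s -> A u) & convex_hull [set` s] x.
Proof.
move: x; apply: convex_hull_sub; last first.
  move=> x Ax; exists [:: x] => [u|]; first by rewrite inE => /eqP ->.
  by apply: sub_convex_hull; rewrite /= mem_head.
move=> t x y t01 [s sA sx] [r rA ry]; exists (s ++ r) => [u|].
  by rewrite mem_cat => /orP[/sA|/rA].
apply: convex_hull_convex => //.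
  by apply: convex_hullS sx => u /= us; rewrite mem_cat us.
by apply: convex_hullS ry => u /= ur; rewrite mem_cat ur orbT.
Qed.

End convex_hulls.

Section slices.
Context (R : realType) (k : scalar_kind).
Context (X : completeNormedModType (scalar_field R k)).
Implicit Types (F H : dual X) (x u : X) (c eta : R).

Definition slice F c : set X := [set u | rnorm u <= 1 /\ c < re (F u)].

Definition far eta x : set X := [set u | rnorm u <= 1 /\ eta <= rnorm (u - x)].

(* If every point x of the slice is adherent to the convex hull of the points
   at distance at least eta, then every point of the slice in the open unit ball
   is an exact convex combination of points at distance at least eta / 2. *)
Lemma bush_step F c eta x : opnorm F = 1 -> 0 < eta ->
  (forall z, slice F c z -> adherent (convex_hull (far eta z)) z) ->
  rnorm x < 1 -> c < re (F x) ->
  convex_hull [set u | rnorm u < 1 /\ eta / 2 < rnorm (u - x)] x.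
Proof.
move=> F1 eta0 bad x1 xc; set A := [set u | _ /\ _].
(* A point at distance eta from z is farther than eta / 2 from x as long as |z - x| < eta / 2. *)
have adh z : rnorm z < 1 -> c < re (F z) -> rnorm (z - x) < eta / 2 ->
    adherent (convex_hull A) z.
  move=> z1 zc zx; apply: adherent_adherent.
  suff farA : convex_hull (far eta z) `<=` adherent (convex_hull A).
    move=> e e0; have [|y Hy ye] := bad z _ e e0; first by split; first exact: ltW.
    by exists y => //; exact: farA.
  apply: convex_hull_sub; first by
    apply: adherent_convex; exact: convex_hull_convex.
  move=> u [u1 uz] e e0.
  (* Scaling u by 1 - del brings it into the open ball, and moves it by less than e and by too
     little to spoil its distance to x. *)
  pose del := Num.min 1 (Num.min (e / 2) ((eta / 2 - rnorm (z - x)) / 2)).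
  have del0 : 0 < del by rewrite !lt_min ltr01 !divr_gt0// subr_gt0.
  have [del1 dele delx] : [/\ del <= 1, del <= e / 2 &
      del <= (eta / 2 - rnorm (z - x)) / 2].
    by rewrite /del !ge_min !lexx !orbT.
  have ud : u - of_real k (1 - del) *: u = of_real k del *: u.
    by rewrite of_realB of_real1 scalerBl scale1r opprB addrC subrK.
  have udn : rnorm (u - of_real k (1 - del) *: u) <= del.
    by rewrite ud rnorm_real gtr0_norm// ler_piMr// ltW.
  exists (of_real k (1 - del) *: u); last by rewrite (le_lt_trans udn)//; lra.
  apply: sub_convex_hull; split.
    rewrite rnorm_real ger0_norm ?subr_ge0// (@le_lt_trans _ _ (1 - del))//.
      by rewrite ler_piMr// subr_ge0.
    by lra.
  have := rnorm_dist_triangle u (of_real k (1 - del) *: u) z.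
  have := rnorm_dist_triangle (of_real k (1 - del) *: u) x z.
  rewrite [rnorm (x - z)]rnorm_distC; lra.
have [a [a1 ax]] : A !=set0.
  have [|y Ay _] := @adh x x1 xc _ 1 ltr01; first by rewrite subrr rnorm0 divr_gt0.
  exact: convex_hull_nonempty Ay.
(* From closure to hull: A contains the ball of radius r about a. Go from x slightly away from a to
   z, and take y in the hull within s r of z. Moving a to b inside the ball absorbs the error, and x
   = (s b + y) / (1 + s). *)
pose r := Num.min (1 - rnorm a) (rnorm (a - x) - eta / 2).
have r0 : 0 < r by rewrite lt_min !subr_gt0 a1 ax.
have rA b : rnorm (b - a) < r -> A b.
  rewrite lt_min => /andP[b1 b2]; split.
    by have := rnormD (b - a) a; rewrite subrK; lra.
  by have := rnorm_dist_triangle a b x; rewrite [rnorm (a - b)]rnorm_distC; lra.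
(* As |x - a| < 2, z is within 2 s of x; the factor 4 keeps z in the open ball, in the slice and
   within eta / 2 of x. *)
pose s := Num.min (1 - rnorm x) (Num.min (re (F x) - c) (eta / 2)) / 4.
have s0 : 0 < s by rewrite divr_gt0// !lt_min !subr_gt0 x1 xc divr_gt0.
have [s1 sc se] : [/\ 4 * s <= 1 - rnorm x, 4 * s <= re (F x) - c & 4 * s <= eta / 2].
  by rewrite /s mulrC divfK// !ge_min !lexx !orbT.
pose z := x + of_real k s *: (x - a).
have xa : rnorm (x - a) < 2 by have := rnormB x a; lra.
have zx : rnorm (z - x) < 2 * s.
  by rewrite /z addrAC subrr add0r rnorm_real gtr0_norm// mulrC ltr_pM2r.
have z1 : rnorm z < 1 by have := rnormD (z - x) x; rewrite subrK; lra.
have zc : c < re (F z).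
  have : re (F (x - z)) <= rnorm (x - z) by apply: dual_re_le1; rewrite F1.
  by rewrite linearB reB rnorm_distC; lra.
have zx' : rnorm (z - x) < eta / 2 by lra.
have [y Ay zy] := adh z z1 zc zx' (s * r) (mulr_gt0 s0 r0).
pose b := a + of_real k s^-1 *: (z - y).
have Ab : A b.
  apply: rA; rewrite /b addrAC subrr add0r rnorm_real gtr0_norm ?invr_gt0//.
  by rewrite ltr_pdivrMl.
have s1' : 0 < 1 + s by rewrite addr_gt0.
have : 0 <= s / (1 + s) <= 1.
  by rewrite divr_ge0 ?(ltW s0) ?(ltW s1')//= ler_pdivrMr// mul1r lerDr.
move=> st; have := convex_hull_convex st (sub_convex_hull Ab) Ay.
congr (convex_hull _ _).
have -> : 1 - s / (1 + s) = (1 + s)^-1 by field; rewrite gt_eqF.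
have -> : s / (1 + s) = (1 + s)^-1 * s by rewrite mulrC.
rewrite of_realM -scalerA -scalerDr.
have -> : of_real k s *: b + y = of_real k (1 + s) *: x.
  rewrite /b scalerDr scalerA -of_realM divff ?gt_eqF// of_real1 scale1r.
  rewrite -addrA subrK /z scalerBr of_realD of_real1 scalerDl scale1r.
  by rewrite [LHS]addrC -!addrA addNr addr0.
by rewrite scalerA -of_realM mulVf ?gt_eqF// of_real1 scale1r.
Qed.

End slices.

Section denting.
Context (R : realType) (k : scalar_kind).
Context (X : completeNormedModType (scalar_field R k)).
Context (rnp : radon_nikodym_property X).
Implicit Types (F H : dual X) (x u : X) (c eta : R).

(* Otherwise a martingale starting deep in the slice, split by [bush_step] inside
   the slice and stopped outside, stays in the slice with probability at least
   1/2, so that its increments do not tend to 0 in L^1. *)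
Lemma exists_not_adherent_far F c eta : opnorm F = 1 -> c < 1 -> 0 < eta ->
  exists2 x, slice F c x & ~ adherent (convex_hull (far eta x)) x.
Proof.
move=> F1 c1 eta0; apply: contrapT => nx.
have bad z : slice F c z -> adherent (convex_hull (far eta z)) z.
  by move=> cz; apply: contrapT => nz; apply: nx; exists z.
pose inside x := rnorm x < 1 /\ c < re (F x).
have step x : exists s : seq (R * X),
    [/\ forall e, e \in s -> 0 <= e.1, rnorm x < 1 ->
        forall e, e \in s -> rnorm e.2 < 1,
        inside x -> forall e, e \in s -> eta / 2 <= rnorm (e.2 - x),
        \sum_(e <- s) e.1 = 1 & \sum_(e <- s) of_real k e.1 *: e.2 = x].
  have [[x1 xc]|nin] := pselect (inside x).
    have [s [sA s1 sx]] := convex_hull_seq (bush_step F1 eta0 bad x1 xc).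
    exists s; split=> // [e /sA[]//|_ e /sA[_ []]//|_ e /sA[_ [_]]].
    exact: ltW.
  exists [:: (1, x)]; split=> [e|x1 e|//||]; rewrite ?big_seq1//=.
  - by rewrite inE => /eqP ->.
  - by rewrite inE => /eqP ->.
  - by rewrite of_real1 scale1r.
have [ch chP] := choice step.
(* This depth makes (F x0 - c) / (1 - c) at least 1/2. The increments then have mean at least eta /
   4, namely eta / 2 with weight 1/2. *)
have [x0 [x01 x0c]] : exists u, rnorm u < 1 /\ (1 + c) / 2 < re (F u).
  by apply: dual_sup; rewrite F1; lra.
have eta4 : 0 < eta / 4 by rewrite divr_gt0.
have Hle x e : rnorm x < 1 -> e \in ch x -> 0 <= e.1 /\ rnorm e.2 < 1.
  by move=> x1 ex; have [h1 h2 _ _ _] := chP x; split; [exact: h1|exact: h2].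
(* the children of a point of norm 1 are irrelevant, but bush_martingale is
   about the closed ball *)
pose ch' x := if rnorm x < 1 then ch x else [:: (1, x)].
have ch'E x : rnorm x < 1 -> ch' x = ch x by rewrite /ch' => ->.
have ch'1 x e : rnorm x <= 1 -> e \in ch' x -> 0 <= e.1 /\ rnorm e.2 <= 1.
  rewrite /ch'; case: ltP => [x1 _ /(Hle _ _ x1)[-> /ltW]|_ x1]//.
  by rewrite inE => /eqP ->.
have ch'2 x : rnorm x <= 1 -> \sum_(e <- ch' x) e.1 = 1.
  rewrite /ch'; case: ltP => _ _; last by rewrite big_seq1.
  by have [] := chP x.
have ch'3 x : rnorm x <= 1 -> \sum_(e <- ch' x) of_real k e.1 *: e.2 = x.
  rewrite /ch'; case: ltP => _ _; last by rewrite big_seq1/= of_real1 scale1r.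
  by have [] := chP x.
have [n] := bush_martingale (ltW x01) ch'1 ch'2 ch'3 rnp eta4.
apply/negP; rewrite -leNgt.
have lev1 i p : p \in tree_level ch' x0 i -> 0 <= p.1 /\ rnorm p.2 < 1.
  elim: i p => [p|i IH p /=]; first by rewrite inE => /eqP ->.
  move=> /flattenP[_ /mapP[q /IH[q0 q1] ->] /mapP[e]].
  rewrite ch'E// => eq -> /=; have [e0 e1] := Hle _ _ q1 eq.
  by rewrite mulr_ge0.
have sum_lev (f : X -> R) i : (forall x, rnorm x < 1 ->
      \sum_(e <- ch x) e.1 * f e.2 = f x) ->
    \sum_(p <- tree_level ch' x0 i) p.1 * f p.2 = f x0.
  move=> fE; elim: i => [|i IH]; first by rewrite big_seq1 mul1r.
  rewrite -IH /= big_flatten big_map big_seq [RHS]big_seq; apply: eq_bigr => p pl.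
  have [p0 p1] := lev1 _ _ pl; rewrite big_map ch'E// -fE// mulr_sumr.
  by apply: eq_bigr => e _; rewrite mulrA.
have sum1 : \sum_(p <- tree_level ch' x0 n) p.1 = 1.
  have := sum_lev (fun=> 1) n; under eq_bigr do rewrite mulr1; apply => x x1.
  by under eq_bigr do rewrite mulr1; have [] := chP x.
have sumF : \sum_(p <- tree_level ch' x0 n) p.1 * re (F p.2) = re (F x0).
  apply: (sum_lev (fun x => re (F x))) => x x1; have [_ _ _ _ {2}<-] := chP x.
  rewrite (real_linear_sum _ _ _ (re_real_linear F)); apply: eq_bigr => e _.
  by rewrite (re_real_linear F).2.
(* Since Re F <= 1 on the ball, (Re F - c) / (1 - c) is at most the indicator of the slice, and the
   martingale preserves its mean. This bounds the weight of the nodes inside the slice from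
   below. *)
have le_term p : p \in tree_level ch' x0 n ->
    p.1 * ((re (F p.2) - c) / (1 - c)) * (eta / 2) <=
    \sum_(e <- ch' p.2) p.1 * e.1 * rnorm (e.2 - p.2).
  move=> pl; have [p0 p1] := lev1 _ _ pl.
  have [pc|pc] := ltP c (re (F p.2)); last first.
    apply: (@le_trans _ _ 0).
      rewrite -mulrA mulr_ge0_le0// mulr_le0_ge0 ?divr_ge0 ?(ltW eta0)//.
      by rewrite mulr_le0_ge0 ?subr_le0// invr_ge0 subr_ge0 ltW.
    rewrite big_seq sumr_ge0// => e ep; have [e0 _] := ch'1 _ _ (ltW p1) ep.
    by rewrite !mulr_ge0// rnorm_ge0.
  have Fp1 : re (F p.2) <= 1.
    by rewrite (le_trans (dual_re_le1 _ _)) ?F1// ltW.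
  have cpos : 0 < 1 - c by rewrite subr_gt0.
  rewrite (@le_trans _ _ (p.1 * (eta / 2)))//.
    rewrite ler_wpM2r ?divr_ge0 ?(ltW eta0)// ler_piMr// ler_pdivrMr// mul1r.
    by rewrite lerD2r.
  have -> : p.1 * (eta / 2) = \sum_(e <- ch' p.2) p.1 * e.1 * (eta / 2).
    by rewrite -mulr_suml -mulr_sumr (ch'2 _ (ltW p1)) mulr1.
  rewrite big_seq [leRHS]big_seq; apply: ler_sum => e ep.
  have [e0 _] := ch'1 _ _ (ltW p1) ep.
  rewrite ler_wpM2l ?mulr_ge0//; move: ep; rewrite ch'E//.
  by have [_ _ h _ _] := chP p.2; exact: h (conj p1 pc) e.
apply: (@le_trans _ _ (\sum_(p <- tree_level ch' x0 n)
    p.1 * ((re (F p.2) - c) / (1 - c)) * (eta / 2))); last first.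
  by rewrite big_seq [leRHS]big_seq; apply: ler_sum => p; exact: le_term.
rewrite -mulr_suml.
have -> : \sum_(p <- tree_level ch' x0 n) p.1 * ((re (F p.2) - c) / (1 - c)) =
    (re (F x0) - c) / (1 - c).
  under eq_bigr do rewrite mulrA mulrBr; rewrite -mulr_suml sumrB sumF.
  by rewrite -mulr_suml sum1 mul1r.
have : 1 / 2 <= (re (F x0) - c) / (1 - c).
  by rewrite ler_pdivlMr ?subr_gt0//; lra.
move=> /(ler_wpM2r (ltW eta0)); lra.
Qed.

Lemma exists_small_slice F c eta : opnorm F = 1 -> c < 1 -> 0 < eta ->
  exists H c', [/\ opnorm H = 1, c' < 1, slice H c' `<=` slice F c &
    forall u u', slice H c' u -> slice H c' u' -> rnorm (u - u') < eta].
Proof.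
move=> F1 c1 eta0.
(* The three bounds serve in turn to make [far d x] nonempty, to give diameter less than eta, and to
   keep the new slice, of radius d about the deep point x, inside the old one. *)
pose d := Num.min (1 / 2) (Num.min (eta / 2) ((1 - c) / 4)).
have d0 : 0 < d by rewrite !lt_min !divr_gt0// subr_gt0.
have [d1 d2 d3] : [/\ d <= 1 / 2, d <= eta / 2 & d <= (1 - c) / 4].
  by rewrite /d !ge_min !lexx !orbT.
have c11 : (1 + c) / 2 < 1 by lra.
have [x [x1 xc] nx] := exists_not_adherent_far F1 c11 d0.
(* The points u and - u are more than 1 apart, so one of them is at distance at least d from x. *)
have [y Fy] : convex_hull (far d x) !=set0.
  have [u [u1 Fu]] : exists u, rnorm u < 1 /\ 1 / 2 < re (F u).
    by apply: dual_sup; rewrite F1; lra.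
  have un : 1 / 2 < rnorm u by rewrite (lt_le_trans Fu)// dual_re_le1 ?F1.
  have := rnorm_dist_triangle u x (- u).
  rewrite opprK -mulr2n -scaler_nat -[2%:R](_ : of_real k 2 = _); last first.
    by rewrite -[2 in LHS]/(1 + 1) of_realD of_real1.
  rewrite rnorm_real ger0_norm// => tri.
  have [ux|ux] := leP d (rnorm (u - x)).
    by exists u; apply: sub_convex_hull; split; [exact: ltW|].
  exists (- u); apply: sub_convex_hull; split; first by rewrite rnormN ltW.
  by rewrite rnorm_distC opprK; lra.
have [H [e [H1 e0 He]]] :=
  separation_adherent (convex_hull_convex (F := far d x)) (ex_intro _ y Fy) nx.
have h0 : 0 < opnorm H.
  rewrite lt_neqAle opnorm_ge0 andbT eq_sym; apply/eqP => /opnorm0_eq0 H0.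
  by have := He _ Fy; rewrite H0 re0; lra.
have [H' H'1 H'E] := dual_normalize h0.
have sl u : slice H' ((opnorm H)^-1 * (re (H x) - e)) u -> rnorm (u - x) < d.
  move=> [u1]; rewrite H'E ltr_pM2l ?invr_gt0// => ux; rewrite ltNge.
  apply/negP => far_u; have := He u; rewrite leNgt ux => /(_ _)/negP; apply => //.
  exact: sub_convex_hull.
exists H', ((opnorm H)^-1 * (re (H x) - e)); split=> //.
- rewrite ltr_pdivrMl// mulr1 (lt_le_trans _ (_ : re (H x) <= _))//.
    by rewrite ltrBlDr ltrDl.
  by rewrite (le_trans (dual_re_le _ _))// ler_piMr// ltW.
- move=> u us; split; first by have [] := us.
  have := sl _ us => ux; have : re (F (x - u)) <= rnorm (x - u).
    by apply: dual_re_le1; rewrite F1.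
  by rewrite linearB reB rnorm_distC; lra.
- move=> u u' /sl us /sl us'; have := rnorm_dist_triangle u x u'.
  by rewrite [rnorm (x - u')]rnorm_distC; lra.
Qed.

(** Stated with small slices instead of closed convex hulls, because the functional that cuts the
    slice is what defines the rank-one operator in [denting_spear_vector]. *)
Definition denting x := rnorm x <= 1 /\ forall eta, 0 < eta ->
  exists H c, [/\ opnorm H = 1, slice H c x &
    forall u, slice H c u -> rnorm (u - x) < eta].

(** Nested slices with diameters tending to 0 shrink to a point by completeness. Each is chosen
    within the previous slice at the raised threshold (1 + h) / 2, so that the limit still satisfies
    the strict inequality with h. *)
Theorem slice_denting F c : opnorm F = 1 -> c < 1 ->
  exists2 x, slice F c x & denting x.
Proof.
move=> F1 c1; pose st := {Fc : dual X * R | opnorm Fc.1 = 1 /\ Fc.2 < 1}.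
have /choice[next nextP] (sn : st * nat) : exists s' : st,
    slice (sval s').1 (sval s').2 `<=`
      slice (sval sn.1).1 ((1 + (sval sn.1).2) / 2) /\
    forall u u', slice (sval s').1 (sval s').2 u ->
      slice (sval s').1 (sval s').2 u' -> rnorm (u - u') < sn.2.+1%:R^-1.
  case: sn => [[[H h] /= [H1 h1]] n].
  have h1' : (1 + h) / 2 < 1 by lra.
  have n0 : 0 < n.+1%:R^-1 :> R by rewrite invr_gt0.
  have [H' [h' [H'1 h'1 sub diam]]] := exists_small_slice H1 h1' n0.
  by exists (exist _ (H', h') (conj H'1 h'1)).
pose s := fix s n : st :=
  if n is n'.+1 then next (s n', n') else exist _ (F, c) (conj F1 c1).
pose S n := slice (sval (s n)).1 (sval (s n)).2.
have SS n : S n.+1 `<=` slice (sval (s n)).1 ((1 + (sval (s n)).2) / 2).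
  exact: (nextP (s n, n)).1.
have sub1 n : S n.+1 `<=` S n.
  move=> u /SS[u1 cu]; split=> //; apply: le_lt_trans cu.
  by have [_ h1] := svalP (s n); lra.
have subn n j : (n <= j)%N -> S j `<=` S n.
  move=> /subnKC <-; elim: (j - n)%N => [|i IH]; first by rewrite addn0.
  by rewrite addnS; exact: subset_trans (sub1 _) IH.
have diam n u u' : S n.+1 u -> S n.+1 u' -> rnorm (u - u') < n.+1%:R^-1.
  exact: (nextP (s n, n)).2.
have /choice[u uS] n : exists u, S n u.
  have [H1 h1] := svalP (s n).
  have [|v [v1 hv]] := @dual_sup _ _ _ (sval (s n)).1 (sval (s n)).2.
    by rewrite H1.
  by exists v; split=> //; exact: ltW.
have small (e : R) : 0 < e -> exists n, n.+1%:R^-1 < e.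
  move=> e0; near \oo => n; exists n; near: n; exact: (near_infty_natSinv_lt (PosNum e0)).
have ucvg : cvgn u.
  apply: rnorm_cauchy_cvg => e /small[n ne]; exists n.+1 => i j ni nj.
  by apply: lt_trans ne; apply: diam; [exact: subn (uS i)|exact: subn (uS j)].
pose x := lim (u n @[n --> \oo]).
have xu (e : R) : 0 < e -> exists N, forall n, (N <= n)%N -> rnorm (x - u n) < e.
  by move=> e0; have /cvg_rnormP/(_ _ e0)[N _ xN] := ucvg; exists N.
have x1 : rnorm x <= 1.
  apply/ler_addgt0Pr => e /xu[N /(_ N (leqnn N)) xe].
  have [u1 _] := uS N.
  by have := rnormD (x - u N) (u N); rewrite subrK; lra.
have xS n : S n x.
  split=> //; have [H1 h1] := svalP (s n).
  set H := (sval (s n)).1 in H1 *; set h := (sval (s n)).2 in h1 *.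
  have e0 : 0 < (1 - h) / 2 by rewrite divr_gt0// subr_gt0.
  have [N xN] := xu _ e0; have := xN _ (leq_maxr n.+1 N) => xe.
  have [_ hu] := SS n _ (subn _ _ (leq_maxl n.+1 N) _ (uS (maxn n.+1 N))).
  have := @dual_re_le1 _ _ _ H (u (maxn n.+1 N) - x).
  rewrite H1 lexx => /(_ isT); rewrite linearB reB rnorm_distC.
  by move: hu; rewrite -/H -/h; lra.
exists x; first exact: (xS 0%N).
split=> // eta /small[n ne]; exists (sval (s n.+1)).1, (sval (s n.+1)).2.
split; [by have [] := svalP (s n.+1)|exact: xS|move=> v vS].
by apply: lt_trans ne; apply: diam => //; exact: xS.
Unshelve. all: by end_near. Qed.

End denting.

(** * Spear and lush operators *)

Section spear_lush.
Context (R : realType) (k : scalar_kind).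
Implicit Types X Y : normedModType (scalar_field R k).

Lemma opnorm_sup X Y (T : blin X Y) (t : R) : t < opnorm T ->
  exists2 u, rnorm u <= 1 & t < rnorm (T u).
Proof.
move=> /(sup_gt (blin_bounded T).1)[_ [u u1 <-] tu]; exists u => //.
by move: u1; rewrite unit_ballE.
Qed.

Lemma spear_set_ub X Y (G T : blin X Y) : opnorm G = 1 ->
  ubound [set rnorm (G + w *: T) | w in @torus R k] (1 + rnorm T).
Proof.
by move=> G1 _ [w w1 <-]; rewrite (le_trans (rnormD _ _))// rnorm_torus// rnorm_blin G1.
Qed.

Lemma spear_equationP X Y (G T : blin X Y) : opnorm G = 1 ->
  spear_equation G T <-> forall e : R, 0 < e -> exists w u,
    [/\ torus w, rnorm u <= 1 & 1 + opnorm T - e < rnorm (G u + w *: T u)].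
Proof.
move=> G1; have ub := @spear_set_ub _ _ G T G1.
have ne : [set rnorm (G + w *: T) | w in @torus R k] !=set0.
  by exists (rnorm (G + 1 *: T)), 1 => //; exact: torus1.
split=> [E e e0|E].
  have : 1 + opnorm T - e < sup [set rnorm (G + w *: T) | w in @torus R k].
    by rewrite E rnorm_blin ltrBlDr ltrDl.
  move=> /(sup_gt ne)[_ [w w1 <-]]; rewrite rnorm_blin => /opnorm_sup[u u1 uE].
  by exists w, u.
apply/le_anti/andP; split; first exact: ge_sup.
apply/ler_addgt0Pr => e /E[w [u [w1 u1 we]]]; rewrite rnorm_blin -lerBlDr.
rewrite (le_trans (ltW we))// (@le_trans _ _ (rnorm (G + w *: T)))//.
  by rewrite rnorm_blin (opnorm_ub (G + w *: T))// unit_ballE.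
by apply: ub_le_sup; [exists (1 + rnorm T)|exists w].
Qed.

(** Take x0 nearly norming T and y the direction of T x0. The separating functional f is almost 1 at
    y and on G F. As x0 is near aconv F, some x in F has |f (T x)| near |T|, and a sign aligns f (T
    x) with f (G x). *)
Lemma lush_spear X Y (G : blin X Y) : lush G -> spear G.
Proof.
move=> [/unit_normE G1 lushG] T; apply/spear_equationP => // e e0.
set t := opnorm T; have [T0|t0] := leP t 0.
  have /opnorm_sup[u u1 ue] : 1 - e < opnorm G by rewrite G1; lra.
  exists 1, u; split=> //; first exact: torus1.
  have /opnorm0_eq0 -> : opnorm T = 0 by apply/le_anti; rewrite T0 opnorm_ge0.
  have -> : G u + 1 *: (0 : blin X Y) u = G u by rewrite scale1r addr0.
  by lra.
(* The bounds keep 1 - del and t - del nonnegative, and the total loss, below del (4 + 2 t), at most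
   e. *)
pose del := Num.min 1 (Num.min (t / 2) (e / (4 + 2 * t))).
have den : 0 < 4 + 2 * t by lra.
have del0 : 0 < del by rewrite !lt_min ltr01 !divr_gt0.
have [del1 delt dele] : [/\ del <= 1, del <= t / 2 & del * (4 + 2 * t) <= e].
  by rewrite -ler_pdivlMr// /del !ge_min !lexx !orbT.
have [|x0 x01 x0t] := @opnorm_sup _ _ T (t - del); first by rewrite ltrBlDr ltrDl.
have Tx0 : T x0 != 0 by rewrite -rnorm_gt0; lra.
have [y y1 Tx0E] := normalize Tx0.
have [||F [FB Fy Fx0]] := lushG x0 del y _ del0; first by rewrite unit_ballE.
  exact/unit_sphereE.
have [v Fv vx0] : exists2 v, aconv F v & rnorm (x0 - v) < del.
  have [_ [v Fv <-]] := ereal_inf_lt Fx0.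
  by rewrite lte_fin; exists v.
have [z Fz] : F !=set0.
  by have [_ [_ _ [z Fz _]]] := convex_hull_nonempty Fv; exists z.
have cF := @convex_hull_convex _ _ _ F.
have [r a b r01 [u Fu <-] [u' Fu' <-]| |_ [u Fu <-]|f f1 fF] :=
    @separation _ _ _ [set G u + y | u in convex_hull F] (2 - del).
- exists (of_real k r *: u + of_real k (1 - r) *: u'); first exact: cF.
  rewrite linearD !linearZ/= !scalerDr addrACA -[in RHS]scalerDl -of_realD.
  by rewrite [r + _]addrC subrK of_real1 scale1r.
- by exists (G z + y), z => //; exact: sub_convex_hull.
- by apply: ltW; have [] := Fy _ Fu.
have fy : 1 - del <= re (f y).
  have : 2 - del <= re (f (G z + y)) by apply: fF; exists z => //; exact: sub_convex_hull.
  have : re (f (G z)) <= 1.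
    rewrite (le_trans (dual_re_le1 _ f1))// -G1 opnorm_ub//; exact: FB.
  by rewrite linearD reD; lra.
(* The first product bounds Re f (T x0) from below, t del pays for moving from x0 to v, and the last
   del is a margin for strictness. *)
pose c := (t - del) * (1 - del) - t * del - del.
(* The function |f (T x)| is convex and invariant under rotations, so a bound on F would extend to
   aconv F, hence to v. *)
have [x Fx cx] : exists2 x, F x & c < rnorm (f (T x)).
  apply: contrapT => nx.
  have : rnorm (f (T v)) <= c.
    move: (v) Fv; apply: convex_hull_sub => [r a b /andP[r0 r1] ac bc|_ [w w1 [x Fx <-]]].
      rewrite /= !linearD !linearZ/= (le_trans (rnormD _ _))// !rnorm_real.
      rewrite !ger0_norm ?subr_ge0//.
      have := ler_wpM2l r0 ac; have : 0 <= 1 - r by rewrite subr_ge0.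
      by move=> /ler_wpM2l/(_ _ _ bc)/=; lra.
    rewrite /= !linearZ/= rnorm_torus// leNgt; apply/negP => cx.
    by apply: nx; exists x.
  have : re (f (T x0)) = rnorm (T x0) * re (f y).
    by rewrite {1}Tx0E (re_real_linear f).2.
  have : re (f (T (x0 - v))) <= t * del.
    rewrite (le_trans (dual_re_le1 _ f1))// (le_trans (rnorm_blin_le _ _))//.
    by rewrite ler_wpM2l ?ltW.
  have : re (f (T v)) <= rnorm (f (T v)) by exact: re_le_rnorm.
  have : (t - del) * (1 - del) <= rnorm (T x0) * re (f y).
    by rewrite ler_pM ?(ltW x0t)//; lra.
  by rewrite !linearB reB /c; lra.
have [w w1 wE] := dual_rotate f (T x).
exists w, x; split=> //; first by have := FB _ Fx; rewrite unit_ballE.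
rewrite (@lt_le_trans _ _ (re (f (G x + w *: T x))))//; last exact: dual_re_le1.
rewrite (re_real_linear f).1 wE of_realK.
have : 2 - del <= re (f (G x + y)) by apply: fF; exists x => //; exact: sub_convex_hull.
have : re (f y) <= 1 by rewrite (le_trans (dual_re_le1 _ f1))// y1.
rewrite linearD reD; move: cx dele; rewrite /c; nra.
Qed.

Lemma spear_alternative_daugavet X Y (G : blin X Y) :
  spear G -> alternative_daugavet G.
Proof. by move=> sG T _; exact: sG. Qed.

(** With phi norming y, each [adjoint T f] is the multiple f y / phi y of [adjoint T phi]. *)
Lemma rank_one_adjoint X Y (T : blin X Y) : rank_one T -> rank_one (adjoint T).
Proof.
move=> [y y0 Ty]; have [phi phi1 phiy] := norming y.
have py : phi y != 0.
  by apply: contraTneq y0 => p0; rewrite -rnorm_eq0 -phiy p0 re0 negbK eqxx.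
have [x _ Tx] : range T y by rewrite Ty; exists 1 => //; rewrite scale1r.
exists (adjoint T phi).
  by apply: contra_neq py => p0; rewrite -Tx -adjointE p0.
apply/seteqP; split=> [_ [f _ <-]|_ [c _ <-]]; last first.
  by exists (c *: phi) => //; rewrite linearZ.
exists ((f y : scalar_field R k) / phi y) => //; apply: blin_eq => u.
have [c _ cE] : [set c *: y | c in [set: scalar_field R k]] (T u).
  by rewrite -Ty; exists u.
rewrite blinZE !adjointE -cE !linearZ/=.
congr (_ *: _); exact: (@divfK (scalar_field R k) (phi y) py (f y)).
Qed.

Lemma alternative_daugavet_adjoint X Y (G : blin X Y) :
  alternative_daugavet (adjoint G) -> alternative_daugavet G.
Proof.
move=> aG T /rank_one_adjoint/aG; rewrite /spear_equation !rnorm_blin opnorm_adjoint.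
move=> <-; congr sup; apply: eq_imagel => w _.
by rewrite -adjointZ -adjointD !rnorm_blin opnorm_adjoint.
Qed.

End spear_lush.

(** * Spear vectors and faces of the dual ball *)

Lemma truncn_dist (R : realType) (N : nat) (a b : R) : (0 < N)%N ->
  -1 <= a -> -1 <= b ->
  Num.truncn (N%:R * (a + 1)) = Num.truncn (N%:R * (b + 1)) ->
  `|a - b| <= N%:R^-1.
Proof.
move=> N0 a1 b1 E; have N0' : 0 < N%:R :> R by rewrite ltr0n.
have A (c : R) : -1 <= c -> (Num.truncn (N%:R * (c + 1)))%:R <= N%:R * (c + 1)
    < (Num.truncn (N%:R * (c + 1)))%:R + 1.
  by move=> c1; rewrite natr1 truncn_itv// mulr_ge0 ?(ltW N0')//; lra.
have /andP[ha1 ha2] := A _ a1; have /andP[] := A _ b1; rewrite -E => hb1 hb2.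
have NV : N%:R * N%:R^-1 = 1 :> R by rewrite divff// gt_eqF.
by rewrite ler_norml; apply/andP; split; rewrite -(ler_pM2l N0') ?mulrN NV; lra.
Qed.

Lemma re_norm_complex_le (R : realType) (z : scalar_field R ComplexScalars) :
  re `|z| <= `|complex.Re z| + `|complex.Im z|.
Proof.
case: z => a b; rewrite /re normc_def/=.
rewrite -[leRHS]ger0_norm ?addr_ge0// -sqrtr_sqr ler_wsqrtr//.
by rewrite sqrrD !real_normK ?num_real// lerD2r lerDl mulrn_wge0// mulr_ge0.
Qed.

(** In the complex case the square around the torus is cut into cells of side 1 / N, and a point of
    the torus is picked in every cell that meets it. *)
Lemma torus_net (R : realType) (k : scalar_kind) (e : R) : 0 < e ->
  exists (I : finType) (w : I -> scalar_field R k),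
    (forall i, torus (w i)) /\
    forall v, torus v -> exists i, re `|v - w i| <= e.
Proof.
move=> e0; case: k.
  exists bool, (fun b => if b then 1 else -1 : R); split.
    by move=> [|]; rewrite /torus/= ?normrN normr1.
  move=> v v1; have : `|v : R| = 1 by [].
  move=> /eqP; rewrite eqr_norml ler01 andbT => /orP[] /eqP ->.
    by exists true; rewrite subrr normr0 /re ltW.
  by exists false; rewrite subrr normr0 /re ltW.
pose K := scalar_field R ComplexScalars.
have [N N0 Ne] : exists2 N : nat, (0 < N)%N & N%:R^-1 < e / 2.
  have e2 : 0 < e / 2 by rewrite divr_gt0.
  have [n] : exists n : nat, n.+1%:R^-1 < e / 2.
    near \oo => n; exists n; near: n; exact: (near_infty_natSinv_lt (PosNum e2)).
  by move=> ne; exists n.+1.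
pose code (v : R[i]) : 'I_(2 * N).+1 * 'I_(2 * N).+1 :=
  (inord (Num.truncn (N%:R * (complex.Re v + 1))),
   inord (Num.truncn (N%:R * (complex.Im v + 1)))).
have /choice[w wP] ij : exists w : K, torus w /\
    forall v : K, torus v -> code v = ij -> code w = ij.
  have [[v [v1 vij]]|nv] := pselect (exists v : K, torus v /\ code v = ij).
    by exists v.
  by exists 1; split; [exact: torus1|move=> v v1 vij; case: nv; exists v].
exists ('I_(2 * N).+1 * 'I_(2 * N).+1)%type, w; split.
  by move=> ij; have [] := wP ij.
have tor (v : K) : torus v -> [/\ -1 <= complex.Re v <= 1 & -1 <= complex.Im v <= 1].
  case: v => a b; rewrite /torus/= normc_def/= => /(congr1 (@complex.Re R))/= ab.
  have : a ^+ 2 + b ^+ 2 = 1.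
    by rewrite -[LHS]sqr_sqrtr ?addr_ge0 ?sqr_ge0// ab expr1n.
  by move=> ab1; split; apply/andP; split; nra.
move=> v v1; exists (code v); have [] := wP (code v).
move: (w (code v)) => u w1 wv.
have := wv v v1 erefl; have [/andP[a1 a2] /andP[b1 b2]] := tor _ v1.
have [/andP[c1 c2] /andP[d1 d2]] := tor _ w1.
have bnd (t : R) : -1 <= t -> t <= 1 -> (Num.truncn (N%:R * (t + 1)) < (2 * N).+1)%N.
  move=> t1 t2; rewrite ltnS -(ler_nat R); apply: (@le_trans _ _ (N%:R * (t + 1))).
    have t0 : 0 <= N%:R * (t + 1) by rewrite mulr_ge0//; lra.
    by have /andP[] := truncn_itv t0.
  by rewrite natrM mulrC ler_wpM2r//; lra.
rewrite /code => -[] /(congr1 (@nat_of_ord _)) + /(congr1 (@nat_of_ord _)).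
rewrite !inordK ?bnd// => Ea Eb.
have := truncn_dist N0 c1 a1 Ea; have := truncn_dist N0 d1 b1 Eb.
move: u v {wv v1 w1 a1 a2 b1 b2 c1 c2 d1 d2 Ea Eb} => [c d] [a b] hb ha.
apply: (le_trans (re_norm_complex_le _)).
by move: ha hb; rewrite /= (distrC c) (distrC d); move: Ne; lra.
Unshelve. all: by end_near. Qed.

(** Points of weight zero may lie outside A: in [spear_vector_face] the points are quotients by
    their weights. The induction runs over normalized partial sums. *)
Lemma real_convex_sum (R : realType) (k : scalar_kind)
    (X : normedModType (scalar_field R k)) (A : set X) (I : Type) (s : seq I)
    (mu : I -> R) (a : I -> X) :
  real_convex A -> (forall i, 0 <= mu i) -> (forall i, mu i != 0 -> A (a i)) ->
  \sum_(i <- s) mu i = 1 -> A (\sum_(i <- s) of_real k (mu i) *: a i).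
Proof.
move=> cA mu0 muA s1; set v := \sum_(i <- s) _.
suff key : 0 < \sum_(i <- s) mu i ->
    A (of_real k (\sum_(i <- s) mu i)^-1 *: v).
  by move: key; rewrite s1 invr1 of_real1 scale1r; apply; exact: ltr01.
have zero (r : seq I) : \sum_(j <- r) mu j = 0 ->
    \sum_(j <- r) of_real k (mu j) *: a j = 0.
  elim: r => [|j r IHr]; first by rewrite !big_nil.
  rewrite !big_cons => /eqP; rewrite paddr_eq0 ?sumr_ge0// => /andP[/eqP -> /eqP r0].
  by rewrite of_real0 scale0r add0r IHr.
rewrite /v {v s1}; elim: s => [|i s IH]; first by rewrite big_nil ltxx.
rewrite !big_cons; set S := \sum_(j <- s) mu j; set V := \sum_(j <- s) _.
have S0 : 0 <= S by apply: sumr_ge0.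
have [i0|i0] := eqVneq (mu i) 0; first by rewrite i0 of_real0 scale0r !add0r.
have [SE|Sn0] := eqVneq S 0.
  by rewrite /V (zero _ SE) SE !addr0 scalerA -of_realM mulVf// of_real1 scale1r => _; exact: muA.
have Sp : 0 < S by rewrite lt_neqAle eq_sym Sn0.
move=> Sum0; have Sumn0 : mu i + S != 0 by rewrite gt_eqF.
have t01 : 0 <= mu i / (mu i + S) <= 1.
  by rewrite divr_ge0 ?(ltW Sum0)//= ler_pdivrMr// mul1r lerDl.
have := cA _ _ _ t01 (muA _ i0) (IH Sp).
have -> : 1 - mu i / (mu i + S) = (mu i + S)^-1 * S.
  by rewrite -{1}(divff Sumn0) -mulrBl addrAC subrr add0r mulrC.
rewrite scalerDr !scalerA -!of_realM mulfK// [_ / _]mulrC.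
by [].
Qed.

Section spear_vector.
Context (R : realType) (k : scalar_kind) (Y : normedModType (scalar_field R k)).
Implicit Types (y z u : Y) (f : dual Y).

Definition spear_vector z := forall y (e : R), 0 < e -> exists w,
  torus w /\ rnorm y + 1 - e < rnorm (y + w *: z).

Definition face z : set (dual Y) := [set f | opnorm f <= 1 /\ 1 <= re (f z)].

Lemma spear_vector_ge1 z : spear_vector z -> 1 <= rnorm z.
Proof.
move=> sz; apply/ler_addgt0Pr => e /(sz 0)[w [w1]].
by rewrite rnorm0 !add0r rnorm_torus// ltrBlDr => /ltW.
Qed.

(** The rotation is moved from z to y, so that t z stays fixed in the functional [h t] of the next
    theorem. *)
Lemma spear_vectorZ z y (t e : R) : spear_vector z -> 0 <= t -> 0 < e ->
  exists w, torus w /\ rnorm y + t - e < rnorm (w *: y + of_real k t *: z).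
Proof.
move=> sz; rewrite le_eqVlt => /predU1P[<-|t0] e0.
  exists 1; split; first exact: torus1.
  by rewrite of_real0 scale0r scale1r !addr0 ltrBlDr ltrDl.
have [w [w1 wE]] := sz (of_real k t^-1 *: y) _ (divr_gt0 e0 t0).
exists w^-1; split; first exact: torusV.
rewrite -(rnorm_torus (_ + of_real k t *: z) w1) scalerDr scalerA divff ?torus_neq0// scale1r.
have -> : y + w *: (of_real k t *: z) =
    of_real k t *: (of_real k t^-1 *: y + w *: z).
  rewrite scalerDr !scalerA -of_realM divff ?gt_eqF// of_real1 scale1r.
  by rewrite [w * _]mulrC.
rewrite rnorm_real gtr0_norm//; move: wE.
rewrite rnorm_real gtr0_norm ?invr_gt0// -(ltr_pM2l t0); apply: le_lt_trans.
by rewrite le_eqVlt; apply/orP; left; apply/eqP; field; rewrite gt_eqF.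
Qed.

Lemma dual_reN f y : re (f (- y)) = - re (f y).
Proof. by rewrite linearN reN. Qed.

Lemma dual_re_eq0 f : (forall y, re (f y) <= 0) -> f = 0.
Proof.
move=> f0; apply: dual_re_inj => y; rewrite re0; apply/le_anti; rewrite f0.
by have := f0 (- y); rewrite dual_reN oppr_le0.
Qed.

(* Let p u = lim_(t -> +oo) |u + t z| - t, the support function of the face. By
   the spear property (1 - e) |y| <= max_i p (w_i y) for a fine net w of the
   torus. Extending (w_i y)_i |-> (1 - e) Re (f0 y) from the diagonal to I -> Y
   below max_i p gives Phi = sum_i Phi_i, where Phi_i <= mu_i p for
   mu_i = Phi_i z; hence Phi_i / mu_i is in the face. *)
Theorem spear_vector_face z f0 (e : R) : rnorm z <= 1 -> spear_vector z ->
  opnorm f0 <= 1 -> 0 < e ->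
  exists2 g, aconv (face z) g & opnorm (f0 - g) < e.
Proof.
move=> z1 sz f01 e0.
have zn : rnorm z = 1 by apply/le_anti; rewrite z1 spear_vector_ge1.
pose h (t : R) u := rnorm (u + of_real k t *: z) - t.
pose p u := inf [set h t u | t in [set t | 0 <= t]].
have hlb t u : [set t | 0 <= t] t -> - rnorm u <= h t u.
  move=> /= t0; have := rnormB_ge (of_real k t *: z) u.
  by rewrite rnorm_real ger0_norm// zn mulr1 [_ *: z + u]addrC /h; lra.
have sp : sublinear p.
  apply: (inf_sublinear (h := h) (b := fun u => - rnorm u)) => //.
  - by exists 0 => /=.
  - move=> s t x y s0 t0; exists (s + t); first exact: addr_ge0.
    rewrite /h of_realD scalerDl addrACA.
    by have := rnormD (x + of_real k s *: z) (y + of_real k t *: z); lra.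
  - move=> t r x t0 r0; exists (r * t); first by rewrite /= mulr_ge0// ltW.
    by rewrite /h of_realM -scalerA -scalerDr rnorm_real gtr0_norm// mulrBr.
have ph t u : 0 <= t -> p u <= h t u.
  move=> t0; apply: ge_inf; last by exists t.
  by exists (- rnorm u) => _ [s s0 <-]; exact: hlb.
have pn u : p u <= rnorm u.
  by rewrite (le_trans (ph 0 u _))// /h of_real0 scale0r addr0 subr0.
have pNz : p (- z) <= -1.
  rewrite (le_trans (ph 1 _ _))// /h of_real1 scale1r addNr rnorm0 sub0r//.
have pz : p z = 1.
  apply/le_anti; rewrite -{1}zn pn/=.
  by have := sublinearN z sp; move: pNz; lra.
have hmono s t u : 0 <= s -> s <= t -> h t u <= h s u.
  move=> s0 st; rewrite /h -{1}(subrK s t) of_realD scalerDl.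
  have := rnormD (of_real k (t - s) *: z) (u + of_real k s *: z).
  rewrite rnorm_real ger0_norm ?subr_ge0// zn mulr1 addrCA; lra.
(* One d pays for the net and one for the spear property, whence kap = 1 - 2 d; the final error is
   at most 2 d < e. *)
pose d := Num.min (e / 4) (1 / 4).
have d0 : 0 < d by rewrite lt_min !divr_gt0.
have [de d1] : d <= e / 4 /\ d <= 1 / 4 by rewrite /d !ge_min !lexx orbT.
pose kap := 1 - 2 * d.
have [I [w [w1 wnet]]] := torus_net k d0.
have [i0 _] := wnet 1 (torus1 R k).
(* Otherwise, as h decreases in t, a single t1 gives h t1 (w_i y) < kap |y| for every i. The sign
   supplied by the spear property at t1 is within d of some w_i, a contradiction. *)
have dom y : exists i, kap * rnorm y <= p (w i *: y).
  apply: contrapT => np.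
  have /choice[t tP] i : exists t, 0 <= t /\ h t (w i *: y) < kap * rnorm y.
    have : p (w i *: y) < kap * rnorm y.
      by rewrite ltNge; apply/negP => ph'; apply: np; exists i.
    move=> /inf_lt[|_ [t t0 <-] th]; first by exists (h 0 (w i *: y)), 0 => /=.
    by exists t.
  pose t1 := \sum_i t i.
  have tle i : t i <= t1.
    rewrite /t1 (bigD1 i)//= lerDl; apply: sumr_ge0 => j _; exact: (tP j).1.
  have t10 : 0 <= t1 by apply: sumr_ge0 => j _; exact: (tP j).1.
  have tlt i : h t1 (w i *: y) < kap * rnorm y.
    by rewrite (le_lt_trans (hmono _ _ _ (tP i).1 (tle i)))//; exact: (tP i).2.
  have y0 : 0 < rnorm y.
    rewrite rnorm_gt0; apply/eqP => y0; have := tlt i0; rewrite y0 scaler0.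
    have := sublinear0 sp; have := ph t1 0 t10; rewrite rnorm0 mulr0; lra.
  have [v [v1 vE]] := spear_vectorZ y sz t10 (mulr_gt0 d0 y0).
  have [i vi] := wnet _ v1; have := tlt i; rewrite /h.
  have := rnormD ((v - w i) *: y) (w i *: y + of_real k t1 *: z).
  rewrite addrA -scalerDl subrK rnormZ.
  have := ler_wpM2r (ltW y0) vi; rewrite /kap; lra.
pose V := I -> Y.
pose mx (u : V) := \big[Num.max/p (u i0)]_i p (u i).
have mxge (u : V) i : p (u i) <= mx u by exact: le_bigmax.
have mxle (u : V) c : (forall i, p (u i) <= c) -> mx u <= c.
  by move=> uc; apply/bigmax_leP; split.
pose L y : V := fun i => w i *: y.
have smx : sublinear (mx : V -> R).
  split=> [u v|r u r0].
    by apply: mxle => i; rewrite (le_trans (sp.1 _ _))// lerD.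
  apply/le_anti/andP; split.
    by apply: mxle => i; rewrite -[(_ *: u) i]/(_ *: u i) sp.2// ler_wpM2l.
  have [->|rn0] := eqVneq r 0.
    rewrite mul0r; apply: le_trans (mxge _ i0).
    by rewrite -[(_ *: u) i0]/(_ *: u i0) of_real0 scale0r (sublinear0 sp).
  have rp : 0 < r by rewrite lt_neqAle eq_sym rn0.
  rewrite -ler_pdivlMl//; apply: mxle => i; rewrite ler_pdivlMl// -sp.2//.
  exact: (mxge (of_real k r *: u)).
have kap0 : 0 <= kap by rewrite /kap; lra.
have domL y : kap * re (f0 y) <= mx (L y).
  have [i iE] := dom y; apply: le_trans (mxge _ i); apply: le_trans iE.
  by rewrite ler_wpM2l// dual_re_le1.
have LD x y : L (x + y) = L x + L y by apply/funext => i; rewrite /L scalerDr.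
have LZ (r : R) x : L (of_real k r *: x) = of_real k r *: L x.
  by apply/funext => i; rewrite /L /= scalerA mulrC -scalerA.
have LN x : L (- x) = - L x by apply/funext => i; rewrite /L scalerN.
pose H y (u : V) := mx (u - L y) + kap * re (f0 y).
pose q (u : V) := inf [set H y u | y in setT].
have Hlb y (u : V) : setT y -> - mx (- u) <= H y u.
  move=> _; have := smx.1 (u - L y) (- u); rewrite addrAC subrr add0r -LN.
  by have := domL (- y); rewrite dual_reN mulrN /H -LN; lra.
have sq : sublinear q.
  apply: (inf_sublinear (h := H) (b := fun u : V => - mx (- u))) => //.
  - by exists 0.
  - move=> x y u v _ _; exists (x + y) => //.
    rewrite /H LD opprD addrACA (re_real_linear f0).1 mulrDr.
    by have := smx.1 (u - L x) (v - L y); lra.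
  - move=> y r u _ r0; exists (of_real k r *: y) => //.
    rewrite /H LZ -scalerBr smx.2 ?(ltW r0)// (re_real_linear f0).2 mulrDr.
    by rewrite mulrCA.
have qH y (u : V) : q u <= H y u.
  apply: ge_inf; last by exists y.
  by exists (- mx (- u)) => _ [x _ <-]; exact: Hlb.
have [Phi lPhi Phiq] := sublinear_minorant sq.
have Phimx (u : V) : Phi u <= mx u.
  rewrite (le_trans (Phiq _))// (le_trans (qH 0 u))// /H linear0 re0 mulr0 addr0.
  by rewrite (_ : L 0 = 0) ?subr0//; apply/funext => i; rewrite /L scaler0.
have PhiL y : Phi (L y) = kap * re (f0 y).
  have le x : Phi (L x) <= kap * re (f0 x).
    rewrite (le_trans (Phiq _))// (le_trans (qH x _))// /H subrr.
    by rewrite (sublinear0 smx) add0r.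
  apply/le_anti; rewrite le/=; have := le (- y).
  by rewrite LN (real_linearN _ lPhi) dual_reN mulrN lerN2.
pose single i y : V := fun j => if j == i then y else 0.
have singleE (u : V) : u = \sum_i single i (u i).
  apply/funext => j; rewrite fct_sumE (bigD1 j)//= /single eqxx big1 ?addr0// => i.
  by rewrite eq_sym => /negbTE ->.
pose phi i y := Phi (single i y).
have PhiE (u : V) : Phi u = \sum_i phi i (u i).
  by rewrite {1}[u]singleE (real_linear_sum _ _ _ lPhi).
have lphi i : real_linear (phi i).
  split=> [x y|r x]; rewrite /phi.
    rewrite -lPhi.1; congr Phi; apply/funext => j; rewrite /single.
    by rewrite -[RHS]/(_ + _); case: ifP => // _; rewrite addr0.
  rewrite -lPhi.2; congr Phi; apply/funext => j; rewrite /single.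
  by rewrite -[RHS]/(_ *: _); case: ifP => // _; rewrite scaler0.
pose mu i := phi i z.
have mu0 i : 0 <= mu i.
  rewrite -oppr_le0 -(real_linearN _ (lphi i)) (le_trans (Phimx _))//.
  apply: mxle => j; rewrite /single; case: ifP => _; first by lra.
  by rewrite (sublinear0 sp).
have mu1 : \sum_i mu i = 1.
  have E : Phi (fun=> z) = \sum_i mu i by rewrite PhiE.
  apply/le_anti; rewrite -E (le_trans (Phimx _)) ?mxle// ?pz//=.
  have : Phi (- (fun=> z)) <= -1.
    by rewrite (le_trans (Phimx _))//; apply: mxle.
  by rewrite (real_linearN _ lPhi) lerN2.
have phip i u : phi i u <= mu i * p u.
  (* Outside coordinate i, the entry (p u) z has p-value at most p u. So Phi v <= p u, which reads
     phi_i u + (1 - mu_i) p u <= p u. *)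
  pose v : V := fun j => if j == i then u else of_real k (p u) *: z.
  have : Phi v <= p u.
    rewrite (le_trans (Phimx _))//; apply: mxle => j; rewrite /v.
    case: ifP => // _; have [u0|u0] := leP 0 (p u).
      by rewrite sp.2// pz mulr1.
    have -> : of_real k (p u) *: z = of_real k (- p u) *: - z.
      by rewrite of_realN scaleNr scalerN opprK.
    by rewrite sp.2; [nra|lra].
  rewrite PhiE (bigD1 i)//= {1}/v eqxx.
  rewrite (eq_bigr (fun j => p u * mu j)) => [|j ji]; last first.
    by rewrite /v (negbTE ji) (lphi j).2.
  rewrite -mulr_sumr; move: mu1; rewrite (bigD1 i)//= => /(canRL (addKr _)) ->.
  by lra.
have /choice[f fE] i : exists f : dual Y, forall y, re (f y) = phi i y.
  apply: (real_linear_dual (lphi i) (C := mu i)) => y.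
  by rewrite (le_trans (phip i y))// ler_wpM2l.
pose g i : dual Y := of_real k (mu i)^-1 *: f i.
have gE i y : re (g i y) = (mu i)^-1 * phi i y.
  by rewrite blinZE -[_ *: _]/(_ * _) re_of_realM fE.
have gface i : mu i != 0 -> face z (g i).
  move=> mui; have mup : 0 < mu i by rewrite lt_neqAle eq_sym mui mu0.
  split; last by rewrite gE mulVf.
  apply: opnorm_re_le => y; rewrite unit_ballE => y1; rewrite gE ler_pdivrMl// mulr1.
  by rewrite (le_trans (phip i y))// ler_piMr// (le_trans (pn y)).
exists (\sum_i of_real k (mu i) *: (w i *: g i)).
  apply: real_convex_sum => //; first exact: convex_hull_convex.
  move=> i mui; apply: sub_convex_hull; exists (w i); first exact: w1.
  by exists (g i) => //; exact: gface.
have -> : \sum_i of_real k (mu i) *: (w i *: g i) = of_real k kap *: f0.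
  apply: dual_re_inj => y; transitivity (\sum_i phi i (w i *: y)).
    rewrite blin_sumE (big_morph _ (@reD R k) (@re0 R k)); apply: eq_bigr => i _.
    rewrite !blinZE -[_ *: _]/(_ * _) re_of_realM.
    have -> : w i *: g i y = g i (w i *: y) by rewrite [RHS]linearZ.
    (* If mu i = 0 then phi i <= 0 everywhere, so phi i vanishes and both sides are 0. *)
    rewrite gE; have [mui|mui] := eqVneq (mu i) 0; last by rewrite mulrA divff// mul1r.
    have -> : phi i (w i *: y) = 0; last by rewrite !mulr0.
    rewrite -fE (_ : f i = 0) ?re0//; apply: dual_re_eq0 => x.
    by rewrite fE (le_trans (phip i x))// mui mul0r.
  rewrite -PhiE -[Phi _]/(Phi (L y)) PhiL blinZE.
  by rewrite -[_ *: f0 y]/(_ * _) re_of_realM.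
rewrite -{1}[f0]scale1r -(of_real1 R k) -scalerBl -of_realB -rnorm_blin rnorm_real.
rewrite rnorm_blin ger0_norm /kap; last by lra.
rewrite (@le_lt_trans _ _ (1 - (1 - 2 * d)))//; last by lra.
by rewrite ler_piMr//; lra.
Qed.

End spear_vector.

(** * Operators on spaces with the Radon-Nikodym property *)

Lemma edistance_lt (R : realType) (k : scalar_kind)
    (V : normedModType (scalar_field R k)) (x y : V) (A : set V) (e : R) :
  A y -> rnorm (x - y) < e -> (edistance x A < e%:E)%E.
Proof.
move=> Ay ye; apply: (@le_lt_trans _ _ (rnorm (x - y))%:E); last by rewrite lte_fin.
by apply: ereal_inf_lbound; exists y.
Qed.

Section radon_nikodym_spear.
Context (R : realType) (k : scalar_kind).
Context (X : completeNormedModType (scalar_field R k)).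
Context (Y : normedModType (scalar_field R k)) (G : blin X Y).
Context (rnp : radon_nikodym_property X) (G1 : opnorm G = 1).

Lemma rank_one_operator (H : dual X) (y : Y) : opnorm H = 1 -> rnorm y = 1 ->
  exists T : blin X Y, [/\ rank_one T, opnorm T = 1 &
    forall u, T u = (H u : scalar_field R k) *: y].
Proof.
move=> H1 y1; pose f u := (H u : scalar_field R k) *: y.
have fl : linear f.
  by move=> a u v; rewrite /f linearP/= scalerDl scalerA.
have fn u : rnorm (f u) = rnorm (H u) by rewrite /f rnormZ y1 mulr1.
have fb u : rnorm (f u) <= 1 * rnorm u by rewrite fn -H1 rnorm_blin_le.
pose T : blin X Y := BLin (is_blin_bounded fl fb).
have T1 : opnorm T = 1.
  by rewrite -H1; congr sup; apply: eq_imagel => u _; exact: fn.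
exists T; split=> //; have y0 : y != 0 by rewrite -rnorm_gt0 y1.
exists y => //; apply/seteqP; split=> [_ [u _ <-]|_ [c _ <-]].
  by exists (H u : scalar_field R k).
have [u [_ Hu]] : exists u, rnorm u < 1 /\ 0 < re (H u).
  by apply: dual_sup; rewrite H1 ltr01.
have Hu0 : (H u : scalar_field R k) != 0.
  by apply: contraTneq Hu => ->; rewrite re0 ltxx.
exists ((c / (H u : scalar_field R k)) *: u) => //=; rewrite /f linearZ/=.
congr (_ *: _); exact: (@divfK (scalar_field R k) _ Hu0 c).
Qed.

Lemma denting_spear_vector x : alternative_daugavet G -> denting x ->
  spear_vector (G x).
Proof.
move=> aG [x1 dx].
have unit_case y (e : R) : rnorm y = 1 -> 0 < e ->
    exists w, torus w /\ 2 - e < rnorm (y + w *: G x).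
  move=> y1 e0; have e4 : 0 < e / 4 by rewrite divr_gt0.
  have [H [c [H1 [_ cx] sx]]] := dx _ e4.
  have [T [rT T1 TE]] := rank_one_operator H1 y1.
  (* The bound 1 - c puts the rotated vector u' into the slice; e / 4 is for one of three errors,
     the others being |u' - x| and 1 - r. *)
  pose kap := Num.min (e / 4) (1 - c).
  have c1 : c < 1 by apply: (lt_le_trans cx); rewrite (le_trans (dual_re_le1 _ _)) ?H1.
  have kap0 : 0 < kap by rewrite lt_min e4 subr_gt0.
  have [kape kapc] : kap <= e / 4 /\ kap <= 1 - c.
    by rewrite /kap !ge_min !lexx orbT.
  have /spear_equationP/(_ _ kap0) := aG _ rT.
  move=> /(_ G1)[w [u [w1 u1]]]; rewrite T1 TE => big.
  have [th th1 thE] := dual_rotate H u; set r := rnorm (H u) in thE.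
  pose u' := th *: u.
  have u'1 : rnorm u' <= 1 by rewrite rnorm_torus.
  have Gle v : rnorm v <= 1 -> rnorm (G v) <= 1.
    by move=> v1; rewrite -G1 opnorm_ub// unit_ballE.
  have big' : 2 - kap < rnorm (G u' + w *: (of_real k r *: y)).
    rewrite (_ : _ + _ = th *: (G u + w *: ((H u : scalar_field R k) *: y))).
      by rewrite rnorm_torus//; move: big; lra.
    have -> : of_real k r = th * (H u : scalar_field R k) by rewrite -thE linearZ.
    rewrite scalerDr /u' linearZ/= !scalerA; congr (_ + _ *: _).
    by rewrite mulrCA mulrA.
  have r1 : 1 - kap < r.
    have := rnormD (G u') (w *: (of_real k r *: y)).
    rewrite rnorm_torus// rnorm_real y1 mulr1 ger0_norm ?rnorm_ge0//.
    by have := Gle _ u'1; lra.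
  have r1' : r <= 1.
    by rewrite /r (le_trans (rnorm_blin_le _ _))// H1 mul1r.
  have u'x : rnorm (u' - x) < e / 4.
    apply: sx; split=> //; rewrite thE of_realK; lra.
  exists w^-1; split; first exact: torusV.
  rewrite -(rnorm_torus (y + _) w1) scalerDr scalerA divff ?torus_neq0// scale1r.
  have : rnorm (G (u' - x)) <= rnorm (u' - x).
    by rewrite (le_trans (rnorm_blin_le _ _))// G1 mul1r.
  have : rnorm (w *: (of_real k r *: y) - w *: y) <= 1 - r.
    rewrite -scalerBr rnorm_torus// -{2}[y]scale1r -(of_real1 R k) -scalerBl.
    by rewrite -of_realB rnorm_real y1 mulr1 distrC ger0_norm// subr_ge0.
  have := rnormD (G (u' - x) + (w *: (of_real k r *: y) - w *: y)) (w *: y + G x).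
  have -> : G (u' - x) + (w *: (of_real k r *: y) - w *: y) + (w *: y + G x) =
      G u' + w *: (of_real k r *: y).
    by rewrite linearB addrA -[_ + _ + w *: y]addrA subrK addrAC subrK.
  have := rnormD (G (u' - x)) (w *: (of_real k r *: y) - w *: y).
  by lra.
(* A unit vector settles the case y = 0, through |y1 + w G x| <= 1 + |G x|. *)
have [y1 y11] : exists y1 : Y, rnorm y1 = 1.
  have [|u u1 Gu] := @opnorm_sup _ _ _ _ G 0; first by rewrite G1 ltr01.
  have /normalize[v v1 _] : G u != 0 by rewrite -rnorm_gt0.
  by exists v.
have Gx1 : rnorm (G x) <= 1 by rewrite -G1 opnorm_ub// unit_ballE.
move=> y e e0; have [->|y0] := eqVneq y 0.
  have [w [w1 wE]] := unit_case y1 e y11 e0; exists w; split=> //.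
  by have := rnormD y1 (w *: G x); rewrite add0r rnorm0 y11; lra.
have [v v1 yE] := normalize y0; set t := rnorm y in yE *.
have t0 : 0 < t by rewrite rnorm_gt0.
have e'0 : 0 < e / (1 + t) by rewrite divr_gt0// addr_gt0.
have [w [w1 wE]] := unit_case v _ v1 e'0; exists w; split=> //.
have wG : rnorm (w *: G x) = rnorm (G x) by rewrite rnorm_torus.
have ee : e / (1 + t) * (1 + t) = e by rewrite divfK// gt_eqF// addr_gt0.
have ee0 : e / (1 + t) <= e by rewrite ler_pdivrMr ?addr_gt0// ler_peMr ?(ltW e0)//; lra.
(* Compare t v + w G x with t (v + w G x) if t >= 1 and with v + w G x otherwise; the difference has
   norm at most |t - 1|. *)
rewrite yE; have [t1|t1] := leP 1 t.
  have : of_real k t *: (v + w *: G x) =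
      (of_real k t *: v + w *: G x) + of_real k (t - 1) *: (w *: G x).
    by rewrite of_realB of_real1 scalerBl scale1r scalerDr addrA addrAC addrK addrC.
  move=> /(congr1 (@rnorm R k Y)); rewrite rnorm_real gtr0_norm// => tE.
  have := rnormD (of_real k t *: v + w *: G x) (of_real k (t - 1) *: (w *: G x)).
  rewrite -tE rnorm_real wG ger0_norm ?subr_ge0//.
  have : (t - 1) * rnorm (G x) <= t - 1 by rewrite ler_piMr// subr_ge0.
  by have : t * (2 - e / (1 + t)) < t * rnorm (v + w *: G x);
    [rewrite ltr_pM2l|move: ee e'0; lra].
have := rnormD (of_real k t *: v + w *: G x) (of_real k (1 - t) *: v).
rewrite addrAC -scalerDl -of_realD addrC [t + _]addrC subrK of_real1 scale1r addrC.
by rewrite rnorm_real v1 ger0_norm ?subr_ge0 ?(ltW t1)//; lra.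
Qed.

Lemma slice_spear_vector (F : dual X) (c : R) : alternative_daugavet G ->
  opnorm F = 1 -> c < 1 -> exists2 x, slice F c x & spear_vector (G x).
Proof.
move=> aG F1 c1; have [x sx dx] := slice_denting rnp F1 c1.
by exists x => //; exact: denting_spear_vector.
Qed.

Lemma alternative_daugavet_lush_adjoint :
  alternative_daugavet G -> lush (adjoint G).
Proof.
move=> aG; split; first by rewrite normal_blinE opnorm_adjoint G1 of_real1.
move=> f e h f1 e0 /unit_sphereE; rewrite rnorm_blin => h1.
move: f1; rewrite unit_ballE rnorm_blin => f1.
have [|x [x1 hx] sx] := slice_spear_vector (c := 1 - e / 2) aG h1; first by lra.
have Gx1 : rnorm (G x) <= 1 by rewrite -G1 opnorm_ub// unit_ballE.
have [g Fg ge] := spear_vector_face Gx1 sx f1 e0.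
exists (face (G x)); split.
- by move=> f' [f'1 _]; rewrite unit_ballE rnorm_blin.
(* The face is convex, so its hull adds nothing; evaluation at x then gives f' (G x) + h x, of real
   part above 2 - e / 2. *)
- have : convex_hull (face (G x)) `<=` face (G x).
    apply: convex_hull_sub => // t a b /andP[t0 t1] [a1 az] [b1 bz]; split.
      rewrite -rnorm_blin (le_trans (rnormD _ _))// !rnorm_real.
      rewrite !ger0_norm ?subr_ge0// !rnorm_blin.
      have := ler_wpM2l t0 a1; have : 0 <= 1 - t by rewrite subr_ge0.
      by move=> /ler_wpM2l/(_ _ _ b1); lra.
    rewrite blinDE !blinZE reD -![_ *: _]/(_ * _) !re_of_realM.
    have := ler_wpM2l t0 az; have : 0 <= 1 - t by rewrite subr_ge0.
    by move=> /ler_wpM2l/(_ _ _ bz); lra.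
  move=> hull f' /hull[f'1 fz]; split; first by rewrite unit_ballE rnorm_blin.
  rewrite rnorm_blin; apply: (@lt_le_trans _ _ (re ((adjoint G f' + h) x))).
    by rewrite blinDE adjointE reD; lra.
  rewrite (le_trans (dual_re_le _ _))// ler_piMr//; exact: opnorm_ge0.
- by apply: (edistance_lt Fg); rewrite rnorm_blin.
Qed.

(** A functional separating x0 from the hull would define, once normalized, a slice of the ball
    without points mapped to spear vectors. *)
Lemma adherent_spear_hull x0 : alternative_daugavet G -> rnorm x0 <= 1 ->
  adherent (convex_hull [set x | rnorm x <= 1 /\ spear_vector (G x)]) x0.
Proof.
move=> aG x01; set D := [set x | _ /\ _]; apply: contrapT => nadh.
have Dslice (F : dual X) c : opnorm F = 1 -> c < 1 ->
    exists2 x, convex_hull D x & c < re (F x).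
  move=> F1 c1; have [x [x1 cx] sx] := slice_spear_vector aG F1 c1.
  by exists x => //; apply: sub_convex_hull.
have [z Dz] : convex_hull D !=set0.
  have [|u _ Gu] := @opnorm_sup _ _ _ _ G 0; first by rewrite G1 ltr01.
  have u0 : u != 0 by apply: contraTneq Gu => ->; rewrite linear0 rnorm0 ltxx.
  have [H _ Hu] := norming u.
  have H0 : 0 < opnorm H.
    rewrite lt_neqAle opnorm_ge0 andbT eq_sym; apply/eqP => /opnorm0_eq0 HE.
    by move: u0; rewrite -rnorm_eq0 -Hu HE re0 eqxx.
  have [H' H'1 _] := dual_normalize H0.
  by have [x Dx _] := Dslice _ _ H'1 ltr01; exists x.
have [F [e [F1 e0 Fe]]] :=
  separation_adherent (convex_hull_convex (F := D)) (ex_intro _ z Dz) nadh.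
have F0 : 0 < opnorm F.
  rewrite lt_neqAle opnorm_ge0 andbT eq_sym; apply/eqP => /opnorm0_eq0 FE.
  by have := Fe _ Dz; rewrite FE re0; lra.
have [F' F'1 F'E] := dual_normalize F0.
have [|x Dx] := Dslice _ ((opnorm F)^-1 * (re (F x0) - e)) F'1.
  rewrite ltr_pdivrMl// mulr1; have := dual_re_le F x0.
  by have := ler_piMr (opnorm_ge0 F) x01; lra.
rewrite F'E ltr_pM2l ?invr_gt0// => xF.
by have := Fe _ Dx; lra.
Qed.

(** The signs are chosen one at a time: each new spear vector adds almost 1 to the norm of the sum
    already built. *)
Lemma spear_vectors_signs (s : seq X) (y : Y) (e : R) :
  (forall x, x \in s -> rnorm x <= 1 /\ spear_vector (G x)) -> 0 < e ->
  exists r : seq X, [/\ forall x, x \in r -> rnorm x <= 1,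
    forall x, x \in s -> exists2 w, torus w & w *: x \in r &
    rnorm y + (size r)%:R - e < rnorm (y + \sum_(x <- r) G x)].
Proof.
elim: s e => [e _ e0|x s IH e xs e0].
  by exists [::]; split=> //; rewrite big_nil !addr0 ltrBlDr ltrDl.
have e2 : 0 < e / 2 by rewrite divr_gt0.
have [|r [r1 rs rE]] := IH _ _ e2; first by move=> z zs; apply: xs; rewrite inE zs orbT.
have [x1 sx] := xs _ (mem_head _ _).
have [w [w1 wE]] := sx (y + \sum_(z <- r) G z) _ e2.
exists (w *: x :: r); split.
- by move=> z; rewrite inE => /predU1P[->|/r1//]; rewrite rnorm_torus.
- move=> z; rewrite inE => /predU1P[->|/rs[v v1 vr]].
    by exists w => //; rewrite mem_head.
  by exists v => //; rewrite inE vr orbT.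
rewrite big_cons linearZ/= [w *: _ + _]addrC addrA; apply: le_lt_trans wE.
by rewrite -natr1; lra.
Qed.

Lemma alternative_daugavet_lush : alternative_daugavet G -> lush G.
Proof.
move=> aG; split; first by rewrite normal_blinE G1 of_real1.
move=> x0 e y; rewrite unit_ballE => x01 e0 /unit_sphereE y1.
have [v /convex_hull_finite[s sD sv] ve] := adherent_spear_hull aG x01 e0.
have [r [r1 rs rE]] := spear_vectors_signs y sD e0.
have [f f1 fE] := norming (y + \sum_(x <- r) G x).
have Gle x : x \in r -> re (f (G x)) <= 1.
  move=> xr; rewrite (le_trans (dual_re_le1 _ f1))// -G1 opnorm_ub// unit_ballE.
  exact: r1.
(* The sum has size r + 1 terms and exceeds size r + 1 - e. The terms other than those of x and y
   are at most 1, so these two together exceed 2 - e. *)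
have fr x : x \in r -> 2 - e < re (f (G x)) + re (f y).
  move=> xr; move: fE rE => <-; rewrite (re_real_linear f).1 y1.
  rewrite (real_linear_sum _ _ _ (re_real_linear f)) (big_rem x xr)/=.
  have : \sum_(z <- rem x r) re (f (G z)) <= (size r)%:R - 1.
    have -> : (size r)%:R - 1 = \sum_(z <- rem x r) 1 :> R.
      have <- : \sum_(z <- r) 1 = (size r)%:R :> R.
        by rewrite big_const_seq count_predT iter_addr_0.
      by rewrite (big_rem x xr)/= addrAC subrr add0r.
    rewrite big_seq [leRHS]big_seq; apply: ler_sum => z /mem_rem; exact: Gle.
  by lra.
pose C := [set x | rnorm x <= 1 /\ 2 - e < re (f (G x)) + re (f y)].
have rC : convex_hull [set` r] `<=` C.
  apply: convex_hull_sub => [t a b /andP[t0 t1] [a1 fa] [b1 fb]|x xr]; last first.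
    by split; [exact: r1|exact: fr].
  split.
    rewrite (le_trans (rnormD _ _))// !rnorm_real !ger0_norm ?subr_ge0//.
    have := ler_wpM2l t0 a1; have : 0 <= 1 - t by rewrite subr_ge0.
    by move=> /ler_wpM2l/(_ _ _ b1); lra.
  rewrite linearD !linearZ/= (re_real_linear f).1 !(re_real_linear f).2.
  have [->|tn0] := eqVneq t 0; first by rewrite mul0r add0r subr0 mul1r.
  have tp : 0 < t by rewrite lt_neqAle eq_sym tn0.
  move: fa; rewrite -(ltr_pM2l tp); have : 0 <= 1 - t by rewrite subr_ge0.
  by move=> /ler_wpM2l/(_ _ _ (ltW fb)); lra.
exists [set` r]; split.
- by move=> x xr; rewrite unit_ballE; exact: r1.
- move=> x /rC[x1 xC]; split; first by rewrite unit_ballE.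
  by rewrite (lt_le_trans xC)// -(re_real_linear f).1 dual_re_le1.
- apply: edistance_lt ve; move: v sv; apply: convex_hull_sub.
    exact: convex_hull_convex.
  (* Undoing the sign, x is a rotation of w x, so the hull of s lies in aconv of r. *)
  move=> x /= xs; have [w w1 wr] := rs _ xs; apply: sub_convex_hull.
  exists w^-1; first exact: torusV.
  by exists (w *: x) => //; rewrite scalerA mulVf ?scale1r// torus_neq0.
Qed.

End radon_nikodym_spear.

Theorem proposition5p20 (R : realType) (k : scalar_kind)
    (X Y : completeNormedModType (scalar_field R k)) (G : blin X Y)
    (rnpX : radon_nikodym_property X) (G1 : `|G| = 1) :
  (alternative_daugavet G -> lush (adjoint G)) /\
  [<-> alternative_daugavet G;
       spear G;
       lush G;
       alternative_daugavet (adjoint G);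
       spear (adjoint G);
       lush (adjoint G)].
Proof.
have G1' := unit_normE G1.
have aL : alternative_daugavet G -> lush G.
  exact: (alternative_daugavet_lush rnpX G1').
have aL' : alternative_daugavet G -> lush (adjoint G).
  exact: (alternative_daugavet_lush_adjoint rnpX G1').
have sa := @spear_alternative_daugavet R k X Y G.
have ls := @lush_spear R k X Y G.
have sa' := @spear_alternative_daugavet R k _ _ (adjoint G).
have ls' := @lush_spear R k _ _ (adjoint G).
have aa := @alternative_daugavet_adjoint R k X Y G.
by split=> //; tfae; tauto.
Qed.
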